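(* Let $\nu(u,v)>0$ be a smooth function in a neighborhood $\mathcal D\subset\mathbb R^2$ of $(u_0,v_0)$ with $\nu_u\,\nu_v\neq 0$, satisfying the partial differential equation $$\Delta\ln\nu=2\,\frac{1-\nu^2}{\nu},$$ where $\Delta=\partial_u^2+\partial_v^2$ is the Laplace operator, and let $l_0X_0Y_0N_0$ be a right oriented orthonormal frame of $\mathbb R^4$. Then there exist a domain $\mathcal D_0$ with $(u_0,v_0)\in\mathcal D_0\subset\mathcal D$ and a unique minimal strongly regular surface $\mathcal M:\ z=l(u,v)$, $(u,v)\in\mathcal D_0$, in $\mathbb S^3$ such that (i) $(u,v)$ are canonical principal parameters; (ii) $l(u_0,v_0)=l_0,\ X(u_0,v_0)=X_0,\ Y(u_0,v_0)=Y_0,\ N(u_0,v_0)=N_0$; (iii) the invariants of $\mathcal M$ are the functions $$\nu_1=\nu,\quad \nu_2=-\nu,\quad \gamma_1=(\sqrt{\nu})_v,\quad \gamma_2=-(\sqrt{\nu})_u .$$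
   Context: $\mathbb S^3$ is the unit sphere centered at the origin of $\mathbb R^4$. Let $\mathcal M:\ z=l(u,v)$ be a smooth regular surface in $\mathbb S^3$ (so $l$ takes values in $\mathbb S^3\subset\mathbb R^4$), with $N$ a smooth unit normal vector field of $\mathcal M$ in $\mathbb S^3$ (tangent to $\mathbb S^3$ and orthogonal to $l_u,l_v$), and with coefficients $E=\langle z_u,z_u\rangle$, $F=\langle z_u,z_v\rangle$, $G=\langle z_v,z_v\rangle$ and $e=\langle z_{uu},N\rangle$, $f=\langle z_{uv},N\rangle$, $g=\langle z_{vv},N\rangle$ of its first and second fundamental forms in $\mathbb S^3$. The parameters $(u,v)$ are called principal if $\mathcal M$ has no umbilical points and $F=f=0$, i.e. the parametric lines are the principal lines. With respect to principal parameters one sets $X=z_u/\sqrt E$, $Y=z_v/\sqrt G$, and the four invariants of $\mathcal M$ are the principal normal curvatures $\nu_1=e/E$, $\nu_2=g/G$ and the principal geodesic curvatures (geodesic curvatures of the principal lines) $\gamma_1=-\dfrac{E_v}{2E\sqrt G}$, $\gamma_2=\dfrac{G_u}{2G\sqrt E}$. The surface, parameterized by principal parameters, is called strongly regular if $(\nu_1-\nu_2)\gamma_1\gamma_2\neq 0$ everywhere. It is minimal if $\nu_1+\nu_2=0$; then one writes $\nu=\nu_1$, $\nu_2=-\nu$, with $\nu>0$ assumed, and strong regularity is equivalent to $\nu_u\nu_v\ne0$. For a minimal strongly regular surface in principal parameters, $\sqrt{\nu E}$ does not depend on $v$ and $\sqrt{\nu G}$ does not depend on $u$; canonical (principal) parameters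 are the principal parameters obtained by the change $\bar u=\int_{u_0}^u\sqrt{\nu E}\,du$, $\bar v=\int_{v_0}^v\sqrt{\nu G}\,dv$, i.e. principal parameters (up to additive constants) for which $E=G=1/\nu$. Subscripts $u,v$ denote partial derivatives. Uniqueness is understood for the surface over the (sufficiently small) neighborhood $\mathcal D_0$ of $(u_0,v_0)$. *)

(* Defs.v *)
From HB Require Import structures.
From mathcomp Require Import all_boot all_order all_algebra.
From mathcomp Require Import all_classical all_reals all_analysis.
Set Implicit Arguments.
Unset Strict Implicit.
Unset Printing Implicit Defensive.
Import Order.TTheory GRing.Theory Num.Theory.
Import numFieldNormedType.Exports.
Local Open Scope classical_set_scope.
Local Open Scope ring_scope.

Section PartialDerivatives.
Context {R : realType} {V : normedModType R}.
Implicit Types f : R * R -> V.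

(* The points of R * R are the pairs (u, v). *)
Definition du f : R * R -> V := fun p => 'D_(1, 0) f p.
Definition dv f : R * R -> V := fun p => 'D_(0, 1) f p.

Definition laplacian f : R * R -> V := fun p => du (du f) p + dv (dv f) p.

(* Iterated partial derivatives: [true] stands for du and [false] for dv;
   the head of the word is applied last. *)
Definition iter_partial (w : seq bool) f : R * R -> V :=
  foldr (fun b h => if b then du h else dv h) f w.

(* Class C^oo on D, meant for open D: partial derivatives of all orders exist
   and are continuous at every point of D. *)
Definition smooth_on (D : set (R * R)) f : Prop :=
  forall (w : seq bool) p, D p ->
    [/\ {for p, continuous (iter_partial w f)},
        derivable (iter_partial w f) p (1, 0) &
        derivable (iter_partial w f) p (0, 1)].

End PartialDerivatives.

Section SurfacesInS3.
Context {R : realType}.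
Implicit Types (l N : R * R -> 'rV[R]_4) (D : set (R * R)).

Definition dotv (x y : 'rV[R]_4) : R := \sum_(i < 4) x 0 i * y 0 i.

Definition frame_mx (a b c d : 'rV[R]_4) : 'M[R]_4 :=
  \matrix_(i < 4) nth 0 [:: a; b; c; d] i.

Definition right_oriented_orthonormal (a b c d : 'rV[R]_4) : Prop :=
  let A := frame_mx a b c d in A *m A^T = 1%:M /\ 0 < \det A.

Definition formE l : R * R -> R := fun p => dotv (du l p) (du l p).
Definition formF l : R * R -> R := fun p => dotv (du l p) (dv l p).
Definition formG l : R * R -> R := fun p => dotv (dv l p) (dv l p).

(* The part of z_uu, z_uv, z_vv normal to S^3 is a multiple of l, hence
   orthogonal to N, so derivatives in R^4 can be used here. *)
Definition forme l N : R * R -> R := fun p => dotv (du (du l) p) (N p).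
Definition formf l N : R * R -> R := fun p => dotv (dv (du l) p) (N p).
Definition formg l N : R * R -> R := fun p => dotv (dv (dv l) p) (N p).

(* A regular surface of S^3 parameterized over D, with a unit normal field N
   tangent to S^3. *)
Definition surface_in_S3 D l N : Prop :=
  [/\ smooth_on D l,
      smooth_on D N,
      forall p, D p -> dotv (l p) (l p) = 1,
      forall p, D p -> free [:: du l p; dv l p] &
      forall p, D p ->
        [/\ dotv (N p) (N p) = 1, dotv (N p) (l p) = 0,
            dotv (N p) (du l p) = 0 & dotv (N p) (dv l p) = 0]].

(* The second fundamental form is proportional to the first one. *)
Definition umbilical l N (p : R * R) : Prop :=
  exists k : R, [/\ forme l N p = k * formE l p,
                    formf l N p = k * formF l p &
                    formg l N p = k * formG l p].

Definition principal_parameters D l N : Prop :=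
  (forall p, D p -> ~ umbilical l N p) /\
  (forall p, D p -> formF l p = 0 /\ formf l N p = 0).

Definition tangentX l : R * R -> 'rV[R]_4 :=
  fun p => (Num.sqrt (formE l p))^-1 *: du l p.
Definition tangentY l : R * R -> 'rV[R]_4 :=
  fun p => (Num.sqrt (formG l p))^-1 *: dv l p.

(* These formulas are meaningful only in principal parameters. *)
Definition nu1 l N : R * R -> R := fun p => forme l N p / formE l p.
Definition nu2 l N : R * R -> R := fun p => formg l N p / formG l p.
Definition gamma1 l : R * R -> R := fun p =>
  - (dv (formE l) p / (2 * formE l p * Num.sqrt (formG l p))).
Definition gamma2 l : R * R -> R := fun p =>
  du (formG l) p / (2 * formG l p * Num.sqrt (formE l p)).

Definition strongly_regular D l N : Prop :=
  principal_parameters D l N /\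
  forall p, D p -> (nu1 l N p - nu2 l N p) * gamma1 l p * gamma2 l p != 0.

Definition minimal D l N : Prop :=
  forall p, D p -> nu1 l N p + nu2 l N p = 0.

(* For a minimal surface, with nu = nu1: the change of parameters
   du' = sqrt (nu E) du, dv' = sqrt (nu G) dv is a translation exactly when
   E = G = 1 / nu; the positivity of nu follows from that of E. *)
Definition canonical_principal_parameters D l N : Prop :=
  principal_parameters D l N /\
  forall p, D p ->
    formE l p = (nu1 l N p)^-1 /\ formG l p = (nu1 l N p)^-1.

Definition has_initial_frame l N (p0 : R * R) (l0 X0 Y0 N0 : 'rV[R]_4) : Prop :=
  [/\ l p0 = l0, tangentX l p0 = X0, tangentY l p0 = Y0 & N p0 = N0].

Definition has_invariants D l N (nu : R * R -> R) : Prop :=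
  forall p, D p ->
    [/\ nu1 l N p = nu p,
        nu2 l N p = - nu p,
        gamma1 l p = dv (fun q => Num.sqrt (nu q)) p &
        gamma2 l p = - du (fun q => Num.sqrt (nu q)) p].

Definition solution_surface D l N (nu : R * R -> R) (p0 : R * R)
    (l0 X0 Y0 N0 : 'rV[R]_4) : Prop :=
  [/\ surface_in_S3 D l N, minimal D l N & strongly_regular D l N] /\
  [/\ canonical_principal_parameters D l N,
      has_initial_frame l N p0 l0 X0 Y0 N0 &
      has_invariants D l N nu].

End SurfacesInS3.

(* Main.v *)
Require Import Defs.
From HB Require Import structures.
From mathcomp Require Import all_boot all_order all_algebra.
From mathcomp Require Import all_classical all_reals all_analysis.
From mathcomp Require Import measurable_realfun ring lra.
Set Implicit Arguments.
Unset Strict Implicit.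
Unset Printing Implicit Defensive.
Import Order.TTheory GRing.Theory Num.Theory.
Import numFieldNormedType.Exports.
Local Open Scope classical_set_scope.
Local Open Scope ring_scope.

(** A surface of the 3-sphere in canonical principal parameters is determined by its
    moving frame [l, X, Y, N].  With [a = nu ^ (-1/2)], [k = nu ^ (1/2)] and
    [phi = (ln nu) / 2], the frame of a minimal surface with the prescribed invariants
    satisfies the linear system

      [l_u = a X],  [X_u = - a l + phi_v Y + k N],  [Y_u = - phi_v X],  [N_u = - k X],
      [l_v = a Y],  [X_v = - phi_u Y],  [Y_v = - a l + phi_u X - k N],  [N_v = k Y],

    that is [Phi_u = A Phi] and [Phi_v = B Phi] with skew-symmetric [A] and [B].  The
    condition of integrability [A_v + A B = B_u + B A] has a single entry that is not
    an identity, namely [phi_uu + phi_vv = a ^ 2 - k ^ 2], and this is the given partial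
    differential equation ([coef_compat], [gauss_equation]).

    Hence the system has exactly one solution for each initial value on a small square
    ([smooth_frobenius]).  The Frobenius theorem is proved for linear systems only: on
    short intervals Picard iteration and a Gronwall inequality need no exponential
    ([linear_ode_exists], [linear_ode_bound]), and the second inequality also shows
    that the solution built by integrating first in [u] along a line and then in [v]
    satisfies the equation in [u] off that line ([solves2_exists]).  The solution is
    smooth because its derivatives are polynomials in itself and in the coefficients
    ([smooth_extension]).

    The frame stays orthonormal because [A] and [B] are skew-symmetric
    ([skew_solutions_dot]), and the fundamental forms and the invariants of its first
    row [l] are then read off the system ([solution_of_integral_frame]).  Conversely
    the frame of any surface with the required properties satisfies the system
    ([integral_frame_of_solution]), so that uniqueness is that of the linear system. *)

(** * One real variable *)

Section OneVariable.
Context {R : realType}.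
Implicit Types (f g : R -> R) (r s t : R).

Lemma ball_convex t0 r s t x :
  `|s - t0| < r -> `|t - t0| < r -> s <= x <= t -> `|x - t0| < r.
Proof.
by rewrite !ltr_norml => /andP[? ?] /andP[? ?] /andP[? ?]; apply/andP; split; lra.
Qed.

(** The bound on [`|c - s|] keeps the intermediate point in every ball centred at
    [s] that contains [t], so that estimates can be localized to such balls. *)
Lemma mvt_ball f df t0 r :
  (forall t, `|t - t0| < r -> is_derive t 1 f (df t)) ->
  forall s t, `|s - t0| < r -> `|t - t0| < r ->
  exists2 c, `|c - t0| < r & [/\ `|c - s| <= `|t - s|
    & f t - f s = df c * (t - s)].
Proof.
move=> fdf.
suff H s t : `|s - t0| < r -> `|t - t0| < r -> s <= t ->
    exists2 c, s <= c <= t & f t - f s = df c * (t - s).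
  move=> s t sr tr; have [st|/ltW ts] := leP s t.
    have [c ct fc] := H _ _ sr tr st; exists c; first exact: ball_convex ct.
    by split=> //; rewrite !ger0_norm; case/andP: ct; lra.
  have [c ct fc] := H _ _ tr sr ts; exists c; first exact: ball_convex ct.
  split; last by rewrite -opprB fc; ring.
  by rewrite !ler0_norm; case/andP: ct; lra.
move=> sr tr st.
have dfx x : x \in `[s, t]%R -> is_derive x 1 f (df x).
  by rewrite in_itv /= => xst; apply/fdf/(ball_convex sr tr).
have fc : {within `[s, t], continuous f}.
  by apply: derivable_within_continuous => x /dfx [].
have dfo x : x \in `]s, t[%R -> is_derive x 1 f (df x).
  rewrite in_itv /= => /andP[sx xt]; apply: dfx.
  by rewrite in_itv /= !ltW.
have [c] := MVT_segment st dfo fc.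
by rewrite in_itv; exists c.
Qed.

Lemma mean_value_bound f df t0 r C :
  (forall t, `|t - t0| < r -> is_derive t 1 f (df t)) ->
  (forall t, `|t - t0| < r -> `|df t| <= C) ->
  forall s t, `|s - t0| < r -> `|t - t0| < r -> `|f t - f s| <= C * `|t - s|.
Proof.
move=> fdf dfC s t sr tr; have [c cr [_ ->]] := mvt_ball fdf sr tr.
by rewrite normrM ler_wpM2r ?dfC.
Qed.

Lemma derivable1_continuous f t df : is_derive t 1 f df -> {for t, continuous f}.
Proof. by case=> fd _; apply/differentiable_continuous/derivable1_diffP. Qed.

(** The primitive is the integral from the left end of the interval: boundedness
    makes [g] integrable there although it need not extend to the closed interval. *)
Lemma exists_primitive g t0 r C :
  (forall t, `|t - t0| < r -> {for t, continuous g}) ->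
  (forall t, `|t - t0| < r -> `|g t| <= C) ->
  exists2 G, G t0 = 0 & forall t, `|t - t0| < r -> is_derive t 1 G (g t).
Proof.
move=> gc gC; set a := t0 - r.
have itvE t : `|t - t0| < r = (a < t < t0 + r) by rewrite ltr_distl.
pose F x := \int[lebesgue_measure]_(t in `]a, x]) g t.
exists (fun t => F t - F t0); first exact: subrr.
move=> t; rewrite itvE => /andP[ta tr].
have [u tu ur] : exists2 u, t < u & u < t0 + r.
  by exists ((t + (t0 + r)) / 2); lra.
have muf : (lebesgue_measure (`]a, u]%classic : set R) < +oo)%E.
  by rewrite lebesgue_measure_itv /=; case: ifP => _; rewrite -?EFinB ltry.
have gi : lebesgue_measure.-integrable `]a, u] (EFin \o g).
  apply: measurable_bounded_integrable.
  - exact: measurable_itv.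
  - exact: muf.
  - apply: (@measurable_funS _ _ _ _ `]a, t0 + r[%classic) => //.
      by move=> x /=; rewrite !in_itv /= => /andP[-> /le_lt_trans]; apply.
    apply: subspace_continuous_measurable_fun => //.
    apply: continuous_in_subspaceT => x; rewrite inE /= in_itv /= -itvE.
    exact: gc.
  - exists `|C|; split=> // x Cx y /=; rewrite in_itv /= => /andP[ay yu].
    apply: le_trans (gC _ _) _; first by rewrite itvE ay (le_lt_trans yu).
    by rewrite (le_trans (ler_norm _) (ltW Cx)).
have [Fd Ft] : derivable F t 1 /\ F^`()%classic t = g t.
  apply: (@continuous_FTC1 R g (BRight a) t u) => //.
  by apply: gc; rewrite itvE ta.
have dF : is_derive t 1 F (g t) by apply: DeriveDef => //; rewrite -derive1E.
by apply: is_derive_eq; rewrite subr0.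
Qed.

(** With [e n = 2 K / 2 ^ n], the sequence [x n - e n] is nondecreasing, [x n + e n]
    is nonincreasing, and the limit is the supremum of the former. *)
Lemma geometric_limit (x : nat -> R) K :
  (forall n, `|x n.+1 - x n| <= K * 2^-1 ^+ n) ->
  exists l, forall n, `|x n - l| <= 2 * K * 2^-1 ^+ n.
Proof.
move=> dx; pose e n : R := 2 * K * 2^-1 ^+ n.
have K0 : 0 <= K by have := dx 0%N; rewrite expr0 mulr1; apply: le_trans.
have e0 n : 0 <= e n by rewrite !mulr_ge0// exprn_ge0.
have eS n : e n.+1 = e n / 2 by rewrite /e exprS; field.
have step n : `|x n.+1 - x n| <= e n / 2.
  by rewrite (le_trans (dx n))// /e; lra.
have mono n m : x n - e n <= x (n + m)%N - e (n + m)%N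
             /\ x (n + m)%N + e (n + m)%N <= x n + e n.
  elim: m => [|m []]; first by rewrite addn0.
  rewrite addnS eS; have := step (n + m)%N; rewrite ler_norml => /andP[].
  by move=> h1 h2 h3 h4; split; lra.
have lo_up n m : x n - e n <= x m + e m.
  have [] := (mono n m, mono m n); rewrite addnC.
  by move=> [h1 h2] [h3 h4]; have := e0 (m + n)%N; lra.
pose S := range (fun n => x n - e n).
have Sub m : ubound S (x m + e m) by move=> _ [n _ <-].
have hS : has_sup S by split; [exists (x 0%N - e 0%N), 0%N | exists (x 0%N + e 0%N)].
exists (sup S) => n; rewrite ler_norml; apply/andP; split.
  rewrite lerBrDr addrC lerBlDr; apply: ge_sup => //.
  by exists (x 0%N - e 0%N), 0%N.
have : x n - e n <= sup S by apply: (sup_upper_bound hS); exists n.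
rewrite -/(e n); lra.
Qed.

Lemma geometric_arbitrarily_small (K eps : R) : 0 < eps ->
  exists n, K * 2^-1 ^+ n < eps.
Proof.
move=> eps0; have := @cvg_geometric R K 2^-1.
rewrite ger0_norm ?invr_ge0// invf_lt1 ?ltr1n// => /(_ isT).
move=> /cvgrPdist_lt /(_ _ eps0) [N _ /(_ N)] /=.
rewrite leqnn sub0r normrN => /(_ isT) h; exists N.
exact: le_lt_trans (ler_norm _) h.
Qed.

Lemma le_of_le_geometric (x y K : R) :
  (forall n, x <= y + K * 2^-1 ^+ n) -> x <= y.
Proof.
move=> h; rewrite leNgt; apply/negP => yx.
have [|n] := @geometric_arbitrarily_small K (x - y); first by rewrite subr_gt0.
have := h n; lra.
Qed.

End OneVariable.

(** * Linear systems of ordinary differential equations on a short interval *)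

Section LinearODE.
Context {R : realType} (n : nat).
Implicit Types (r s t : R) (y g : 'I_n -> R -> R) (b : 'I_n -> 'I_n -> R -> R).

Definition solves b y g t0 r :=
  forall i t, `|t - t0| < r ->
    is_derive t 1 (y i) (\sum_k b i k t * y k t + g i t).

Lemma sum_mul_bound (b y : 'I_n -> R) M K :
  (forall k, `|b k| <= M) -> (forall k, `|y k| <= K) ->
  `|\sum_k b k * y k| <= n%:R * M * K.
Proof.
move=> bM yK; apply: le_trans (ler_norm_sum _ _ _) _.
have -> : n%:R * M * K = \sum_(k < n) M * K.
  by rewrite sumr_const card_ord -[RHS]mulr_natl mulrA.
by apply: ler_sum => k _; rewrite normrM ler_pM.
Qed.

Lemma le_sum_term (K : 'I_n -> R) k : (forall j, 0 <= K j) -> K k <= \sum_j K j.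
Proof. by move=> K0; rewrite (bigD1 k) //= lerDl sumr_ge0. Qed.

Lemma bounded_on_segment (f : R -> R) t0 r rho : rho < r ->
  (forall t, `|t - t0| < r -> {for t, continuous f}) ->
  exists2 K, 0 <= K & forall t, `|t - t0| <= rho -> `|f t| <= K.
Proof.
move=> rr fc; have fw : {within `[t0 - rho, t0 + rho], continuous f}.
  apply: continuous_in_subspaceT => t; rewrite inE /= in_itv /= -ler_distl => h.
  exact/fc/(le_lt_trans h).
have := compact_bounded (continuous_compact fw (@segment_compact _ _ _)).
move=> [K [_ HK]]; exists (`|K| + 1); first by rewrite addr_ge0.
move=> t tr; apply: (HK (`|K| + 1)); first by rewrite (le_lt_trans (ler_norm _))// ltrDl.
by exists t => //=; rewrite in_itv /= -ler_distl.
Qed.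

(** A Gronwall inequality.  On an interval so short that [n * M * r <= 1/2] the
    mean value theorem turns a bound [2 (delta + r eps) + K] into
    [2 (delta + r eps) + K / 2], so that [K] can be made arbitrarily small. *)
Lemma linear_ode_bound b y g t0 r M delta eps :
  n%:R * M * r <= 2^-1 ->
  (forall i k t, `|t - t0| < r -> `|b i k t| <= M) ->
  (forall i t, `|t - t0| < r -> `|g i t| <= eps) ->
  (forall i, `|y i t0| <= delta) ->
  solves b y g t0 r ->
  forall i t, `|t - t0| < r -> `|y i t| <= 2 * (delta + r * eps).
Proof.
move=> nMr bM geps y0 ysol i t tr.
have r0 : 0 < r by apply: le_lt_trans tr.
have eps0 : 0 <= eps by apply: le_trans (normr_ge0 _) (geps i t tr).
have nM0 : 0 <= n%:R * M.
  by rewrite mulr_ge0// (le_trans (normr_ge0 _) (bM i i t tr)).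
have /choice[K HK] : forall k, exists K, 0 <= K /\
    forall s, `|s - t0| <= `|t - t0| -> `|y k s| <= K.
  move=> k; have [|K ? ?] := @bounded_on_segment (y k) t0 r `|t - t0| tr.
    by move=> s sr; apply: derivable1_continuous (ysol k s sr).
  by exists K.
suff H m k s : `|s - t0| <= `|t - t0| ->
    `|y k s| <= 2 * (delta + r * eps) + (\sum_k K k) * 2^-1 ^+ m.
  by apply: le_of_le_geometric => m; apply: H.
elim: m k s => [|m IH] k s sr.
  rewrite expr0 mulr1; have := (HK k).2 s sr.
  have : K k <= \sum_j K j by apply: le_sum_term => j; case: (HK j).
  by have := le_trans (normr_ge0 _) (y0 i); have := mulr_ge0 (ltW r0) eps0; lra.
have t00 : `|t0 - t0| < r by rewrite subrr normr0.
(* The point [c] stays in the closed ball of radius [`|t - t0|], where [K] bounds [y]. *)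
have [c cr [cs E]] := mvt_ball (ysol k) t00 (le_lt_trans sr tr); set S := \sum_k0 K k0 in IH *.
have cs' : `|c - t0| <= `|t - t0| by apply: le_trans sr.
have := sum_mul_bound (fun j => bM k j c cr) (fun j => IH j c cs').
have := geps k c cr; have := y0 k; rewrite exprS.
set d := \sum_(j < n) _ in E *; set e := 2^-1 ^+ m => yk gk dk.
have {}dk : `|d + g k c| <= n%:R * M * (2 * (delta + r * eps) + S * e) + eps.
  by apply: le_trans (ler_normD _ _) _; apply: lerD.
have : `|y k s - y k t0| <=
    (n%:R * M * (2 * (delta + r * eps) + S * e) + eps) * r.
  by rewrite E normrM ler_pM// ltW// (le_lt_trans sr).
have B0 : 0 <= 2 * (delta + r * eps) + S * e.
  by apply: le_trans (normr_ge0 _) (IH k c cs').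
have := ler_wpM2r B0 nMr.
have : `|y k s| <= `|y k t0| + `|y k s - y k t0|.
  by rewrite -{1}(subrK (y k t0) (y k s)) addrC ler_normD.
move: B0; set B := _ + _ * e => B0 h1 h2 h3.
have : B = 2 * (delta + r * eps) + S * e by []; nra.
Qed.

(** Picard iteration: on an interval so short that [n * M * r <= 1/2] the Picard
    transform [Phi] halves distances, hence the iterates converge geometrically.
    The limit [y] is identified with [Phi y], which is differentiable by
    construction. *)
Lemma linear_ode_exists b (y0 : 'I_n -> R) t0 r M :
  0 < r -> n%:R * M * r <= 2^-1 ->
  (forall i k t, `|t - t0| < r -> {for t, continuous (b i k)}) ->
  (forall i k t, `|t - t0| < r -> `|b i k t| <= M) ->
  exists2 y, (forall i, y i t0 = y0 i) & solves b y (fun _ _ => 0) t0 r.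
Proof.
move=> r0 nMr bc bM.
have t00 : `|t0 - t0| < r by rewrite subrr normr0.
pose P y := exists K, forall i t, `|t - t0| < r ->
  {for t, continuous (y i)} /\ `|y i t| <= K.
pose Q y z := forall i, z i t0 = y0 i /\
  forall t, `|t - t0| < r -> is_derive t 1 (z i) (\sum_k b i k t * y k t).
have /choice[Phi PhiQ] y : exists z, P y -> Q y z.
  have [[K yK]|] := pselect (P y); last by exists y.
  have /choice[z zP] i : exists z, z t0 = y0 i /\
      forall t, `|t - t0| < r -> is_derive t 1 z (\sum_k b i k t * y k t).
    have [||G G0 GP] := @exists_primitive R (fun t => \sum_k b i k t * y k t)
                          t0 r (n%:R * M * K).
    - move=> t tr; apply: cvg_big => [|k _]; first exact: add_continuous.
      exact: cvgM (bc i k t tr) (yK k t tr).1.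
    - by move=> t tr; apply: sum_mul_bound => k; [apply: bM | case: (yK k t tr)].
    exists (fun t => y0 i + G t); split; first by rewrite G0 addr0.
    move=> t tr; rewrite -[X in is_derive _ _ _ X]add0r.
    exact: is_deriveD (is_derive_cst (y0 i) t 1) (GP t tr).
  by exists z => _ i; apply: zP.
have QP y z : P y -> Q y z -> P z.
  move=> [K yK] Qz; exists (\sum_i `|y0 i| + n%:R * M * K * r) => i t tr.
  split; first by apply: derivable1_continuous ((Qz i).2 t tr).
  have dK s : `|s - t0| < r -> `|\sum_k b i k s * y k s| <= n%:R * M * K.
    by move=> sr; apply: sum_mul_bound => k; [apply: bM | case: (yK k s sr)].
  have := mean_value_bound (Qz i).2 dK t00 tr; rewrite (Qz i).1 => h.
  rewrite -(subrK (y0 i) (z i t)) addrC; apply: le_trans (ler_normD _ _) _.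
  apply: lerD; first exact: (@le_sum_term (fun j => `|y0 j|)).
  have nMK := le_trans (normr_ge0 _) (dK t0 t00).
  by apply: le_trans h _; rewrite ler_wpM2l // ltW.
have contract y y' z z' C : 0 <= C -> Q y z -> Q y' z' ->
    (forall i t, `|t - t0| < r -> `|y i t - y' i t| <= C) ->
    forall i t, `|t - t0| < r -> `|z i t - z' i t| <= C * 2^-1.
  move=> C0 Qz Qz' yC i t tr.
  have dd s : `|s - t0| < r -> is_derive s 1 (fun x => z i x - z' i x)
      (\sum_k b i k s * (y k s - y' k s)).
    move=> sr; have := (Qz i).2 s sr; have := (Qz' i).2 s sr => ? ?.
    apply: is_derive_eq; rewrite -sumrB; apply: eq_bigr => k _.
    by rewrite mulrBr.
  have dC s : `|s - t0| < r ->
      `|\sum_k b i k s * (y k s - y' k s)| <= n%:R * M * C.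
    by move=> sr; apply: sum_mul_bound => k; [apply: bM | apply: yC].
  have := mean_value_bound dd dC t00 tr; rewrite (Qz i).1 (Qz' i).1 subrr subr0.
  have nMC := le_trans (normr_ge0 _) (dC t0 t00).
  move=> /le_trans; apply; rewrite [leRHS]mulrC.
  apply: le_trans (ler_wpM2l nMC (ltW tr)) _.
  by rewrite mulrAC ler_wpM2r.
pose Y m := iter m Phi (fun i _ => y0 i).
have YP m : P (Y m).
  elim: m => [|m IH]; last exact: QP (PhiQ _ IH).
  exists (\sum_i `|y0 i|) => i t _; split; first exact: cst_continuous.
  exact: (@le_sum_term (fun j => `|y0 j|)).
have YQ m : Q (Y m) (Y m.+1) by apply: PhiQ.
have [C C0 YC] : exists2 C, 0 <= C & forall m i t, `|t - t0| < r ->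
    `|Y m.+1 i t - Y m i t| <= C * 2^-1 ^+ m.
  have [[K1 H1] [K0 H0]] := (YP 1%N, YP 0%N).
  exists (`|K1| + `|K0|); first by rewrite addr_ge0.
  elim=> [|m IH] i t tr.
    rewrite expr0 mulr1 (le_trans (ler_normB _ _))// lerD//.
      exact: le_trans (H1 i t tr).2 (ler_norm _).
    exact: le_trans (H0 i t tr).2 (ler_norm _).
  have Cm : 0 <= (`|K1| + `|K0|) * 2^-1 ^+ m.
    by apply: mulr_ge0; [apply: addr_ge0 | apply: exprn_ge0].
  rewrite exprSr mulrA; exact: (contract _ _ _ _ _ Cm (YQ m.+1) (YQ m) IH i t tr).
have /choice[y yY] i : exists yi, forall t, `|t - t0| < r ->
    forall m, `|Y m i t - yi t| <= 2 * C * 2^-1 ^+ m.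
  have /choice[yi H] t : exists l, `|t - t0| < r ->
      forall m, `|Y m i t - l| <= 2 * C * 2^-1 ^+ m.
    have [tr|] := boolP (`|t - t0| < r); last by exists 0.
    have [l Hl] := geometric_limit (fun m => YC m i t tr).
    by exists l.
  by exists yi.
have yP : P y.
  have [K HK] := YP 0%N; exists (K + 2 * C) => i t tr; split; last first.
    have := yY i t tr 0%N; rewrite expr0 mulr1 distrC => h.
    rewrite -(subrK (Y 0%N i t) (y i t)) addrC; apply: le_trans (ler_normD _ _) _.
    by apply: lerD h; case: (HK i t tr).
  apply/cvgrPdist_lt => eps eps0.
  have [|m Hm] := @geometric_arbitrarily_small R (2 * C) (eps / 3).
    by rewrite divr_gt0.
  have [Km HKm] := YP m.
  have /cvgrPdist_lt/(_ (eps / 3)) := (HKm i t tr).1.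
  rewrite divr_gt0// => /(_ isT) cm.
  near=> s; have sr : `|s - t0| < r.
    near: s; exists (r - `|t - t0|); first by rewrite /= subr_gt0.
    move=> s /=; rewrite ltrBrDr distrC; apply: le_lt_trans.
    by rewrite -(subrKA t s (- t0)) ler_normD.
  have h1 := yY i t tr m; have h2 := yY i s sr m.
  have h3 : `|Y m i t - Y m i s| < eps / 3 by near: s.
  move: h1 h2 h3; rewrite !ler_norml !ltr_norml.
  move=> /andP[? ?] /andP[? ?] /andP[? ?]; apply/andP; split; lra.
have zQ := PhiQ y yP; set z := Phi y in zQ.
have zy i t : `|t - t0| < r -> z i t = y i t.
  move=> tr; apply/eqP; rewrite -subr_eq0 -normr_le0.
  apply: (@le_of_le_geometric R _ _ (2 * C)) => m; rewrite add0r.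
  have zY : `|z i t - Y m.+1 i t| <= 2 * C * 2^-1 ^+ m * 2^-1.
    apply: (contract _ _ _ _ _ _ zQ (YQ m)) tr => [|k s sr].
      by apply: mulr_ge0; [apply: mulr_ge0 | apply: exprn_ge0].
    by rewrite distrC; apply: yY.
  have := yY i t tr m.+1; rewrite exprSr mulrA => Yy.
  rewrite -(subrKA (Y m.+1 i t)); apply: le_trans (ler_normD _ _) _; lra.
exists z => [i | i t tr]; first by case: (zQ i).
rewrite addr0; have -> : \sum_k b i k t * z k t = \sum_k b i k t * y k t.
  by apply: eq_bigr => k _; rewrite zy.
exact: (zQ i).2.
Unshelve. all: by end_near. Qed.

End LinearODE.

(** * Integrable linear systems in two variables *)

Section TotalSystem.
Context {R : realType} (n : nat).
Implicit Types (r s t u v : R) (y : 'I_n -> R -> R -> R)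
  (A B : 'I_n -> 'I_n -> R -> R -> R).

Lemma is_derive1P (f : R -> R) t df :
  is_derive t 1 f df <->
  forall eps, 0 < eps ->
    \forall h \near 0, `|f (t + h) - f t - h * df| <= eps * `|h|.
Proof.
have quotE h : h != 0 -> `|df - h^-1 *: ((f \o shift t) (h *: 1) - f t)| =
    `|f (t + h) - f t - h * df| / `|h|.
  move=> h0; rewrite /= [h *: 1]mulr1 [h^-1 *: _]mulrC (addrC h) -normf_div distrC.
  by congr `| _ |; field.
split=> [[dft dfE] eps eps0 | H].
  have : (fun h => h^-1 *: ((f \o shift t) (h *: 1) - f t)) @ 0^' --> df.
    by rewrite -dfE; exact: dft.
  move=> /cvgrPdist_le /(_ _ eps0); rewrite near_withinE; apply: filter_app.
  near=> h; have [->|h0] := eqVneq h 0.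
    by rewrite addr0 subrr mul0r subrr !normr0 mulr0.
  by move=> /(_ isT); rewrite quotE// ler_pdivrMr ?normr_gt0.
have ft : (fun h => h^-1 *: ((f \o shift t) (h *: 1) - f t)) @ 0^' --> df.
  apply/cvgrPdist_le => eps eps0; rewrite near_withinE.
  apply: filter_app (H _ eps0); near=> h => + h0.
  by rewrite quotE// ler_pdivrMr ?normr_gt0.
by apply: DeriveDef; [apply: cvgP ft | apply: cvg_lim ft].
Unshelve. all: by end_near. Qed.

Lemma is_derive1_sum (f df : 'I_n -> R -> R) t :
  (forall k, is_derive t 1 (f k) (df k t)) ->
  is_derive t 1 (fun s => \sum_k f k s) (\sum_k df k t).
Proof.
move=> fdf; have -> : (fun s => \sum_k f k s) = \sum_k f k.
  by apply/funext => s; rewrite fct_sumE.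
exact: is_derive_sum.
Qed.

Lemma is_derive1M (f g : R -> R) t df dg :
  is_derive t 1 f df -> is_derive t 1 g dg ->
  is_derive t 1 (fun s => f s * g s) (df * g t + f t * dg).
Proof.
move=> fdf gdg; apply: is_derive_eq (is_deriveM fdf gdg) _.
by rewrite /GRing.scale /= addrC; congr (_ + _); apply: mulrC.
Qed.

(** Two uses of the mean value theorem; they cost the factor [1/2] of Taylor's
    formula. *)
Lemma taylor2_bound (f f' f'' : R -> R) t0 r M :
  (forall t, `|t - t0| < r -> is_derive t 1 f (f' t)) ->
  (forall t, `|t - t0| < r -> is_derive t 1 f' (f'' t)) ->
  (forall t, `|t - t0| < r -> `|f'' t| <= M) ->
  forall s t, `|s - t0| < r -> `|t - t0| < r ->
    `|f t - f s - (t - s) * f' s| <= M * `|t - s| ^+ 2.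
Proof.
move=> df df' f''M s t sr tr; have [c cr [cs ->]] := mvt_ball df sr tr.
rewrite [f' c * _]mulrC -mulrBr normrM mulrC expr2 mulrA ler_wpM2r//.
apply: le_trans (mean_value_bound df' f''M sr cr) _.
by rewrite ler_wpM2l// (le_trans (normr_ge0 _) (f''M s sr)).
Qed.

Section Square.
Variables (u0 v0 r M : R) (A B Av Bu Buu : 'I_n -> 'I_n -> R -> R -> R).
Hypotheses (r0 : 0 < r) (nMr : n%:R * M * r <= 2^-1).
Let U u := `|u - u0| < r.
Let V v := `|v - v0| < r.
Hypotheses (AM : forall i k u v, U u -> V v -> `|A i k u v| <= M)
           (BM : forall i k u v, U u -> V v -> `|B i k u v| <= M).

Definition solves2 y := forall i u v, U u -> V v ->
  is_derive u 1 (fun s => y i s v) (\sum_k A i k u v * y k u v) /\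
  is_derive v 1 (y i u) (\sum_k B i k u v * y k u v).

Lemma solves2_bound y delta : solves2 y -> (forall i, `|y i u0 v0| <= delta) ->
  forall i u v, U u -> V v -> `|y i u v| <= 4 * delta.
Proof.
move=> ysol y0 i u v Uu Vv.
have Uu0 : U u0 by rewrite /U subrr normr0.
have Vv0 : V v0 by rewrite /V subrr normr0.
have twice (d : R) : 2 * (d + r * 0) = 2 * d by rewrite mulr0 addr0.
have yu k s : U s -> `|y k s v0| <= 2 * delta.
  move=> Us; rewrite -twice.
  apply: (linear_ode_bound (b := fun i k s => A i k s v0)
    (y := fun i s => y i s v0) (g := fun _ _ => 0) nMr) Us => //.
  - by move=> *; apply: AM.
  - by move=> *; rewrite normr0.
  - by move=> j x Ux; rewrite addr0; case: (ysol j x v0 Ux Vv0).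
have -> : 4 * delta = 2 * (2 * delta) by ring.
rewrite -twice; apply: (linear_ode_bound (b := fun i k => B i k u)
    (y := fun i => y i u) (g := fun _ _ => 0) nMr) Vv => //.
- by move=> *; apply: BM.
- by move=> *; rewrite normr0.
- by move=> j; apply: yu.
- by move=> j x Vx; rewrite addr0; case: (ysol j u x Uu Vx).
Qed.

Hypotheses
  (Auc : forall i k u, U u -> {for u, continuous (fun s => A i k s v0)})
  (Avd : forall i k u v, U u -> V v -> is_derive v 1 (A i k u) (Av i k u v))
  (Bvc : forall i k u v, U u -> V v -> {for v, continuous (B i k u)})
  (Bud : forall i k u v, U u -> V v ->
     is_derive u 1 (fun s => B i k s v) (Bu i k u v))
  (Buud : forall i k u v, U u -> V v ->
     is_derive u 1 (fun s => Bu i k s v) (Buu i k u v))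
  (BuM : forall i k u v, U u -> V v -> `|Bu i k u v| <= M)
  (BuuM : forall i k u v, U u -> V v -> `|Buu i k u v| <= M)
  (compat : forall i k u v, U u -> V v ->
     Av i k u v + \sum_j A i j u v * B j k u v =
     Bu i k u v + \sum_j B i j u v * A j k u v).

(** The Frobenius theorem for a linear system.  The system is integrated along
    the line [v = v0] in [u], then along the lines [u = const] in [v].  For fixed
    [u], the defect [y(u + h, v) - y(u, v) - h A(u, v) y(u, v)] satisfies, by the
    compatibility condition, the equation in [v] up to an error of order [h^2],
    so it is [o(h)] by the Gronwall inequality as soon as it is on [v = v0]; hence
    the equation in [u] persists off that line.  This estimate does the work of a
    theorem on the differentiability of solutions with respect to parameters. *)
Lemma solves2_exists (y0 : 'I_n -> R) :
  exists2 y, (forall i, y i u0 v0 = y0 i) & solves2 y.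
Proof.
have Uu0 : U u0 by rewrite /U subrr normr0.
have Vv0 : V v0 by rewrite /V subrr normr0.
have [P P0 Psol] := @linear_ode_exists R n (fun i k s => A i k s v0) y0 u0 r M r0
  nMr Auc (fun i k s Us => AM i k Us Vv0).
have /choice[Y HY] : forall u, exists z : 'I_n -> R -> R, U u ->
    (forall i, z i v0 = P i u) /\
    solves (fun i k => B i k u) z (fun _ _ => 0) v0 r.
  move=> u; have [Uu|/negP nU] := boolP (`|u - u0| < r); last by exists (fun _ _ => 0).
  have [z z0 zs] := @linear_ode_exists R n (fun i k => B i k u) (fun i => P i u)
    v0 r M r0 nMr (fun i k v Vv => @Bvc i k u v Uu Vv) (fun i k v Vv => BM i k Uu Vv).
  by exists z.
pose y i u v := Y u i v.
have yv i u v : U u -> V v ->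
    is_derive v 1 (y i u) (\sum_k B i k u v * y k u v).
  by move=> Uu Vv; have := (HY u Uu).2 i v Vv; rewrite addr0.
have yP i u : U u -> y i u v0 = P i u by move=> /HY[+ _]; apply.
exists y => [i|]; first by rewrite yP.
move=> i u v Uu Vv; split; last exact: yv.
pose K := 2 * (\sum_k `|P k u| + r * 0).
have yK k w : V w -> `|y k u w| <= K.
  move=> Vw; apply: (linear_ode_bound (b := fun i k => B i k u)
    (y := fun i => y i u) (g := fun _ _ => 0) nMr) Vw => //.
  - by move=> *; apply: BM.
  - by move=> *; rewrite normr0.
  - by move=> j; rewrite yP// (@le_sum_term _ _ (fun k => `|P k u|)).
  - by move=> j x Vx; rewrite addr0; apply: yv.
pose Z k w := \sum_j A k j u w * y j u w.
have ZK k w : V w -> `|Z k w| <= n%:R * M * K.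
  by move=> Vw; apply: sum_mul_bound => j; [apply: AM | apply: yK].
pose C := n%:R * M * K + n%:R * M * (n%:R * M * K).
pose defect h k w := y k (u + h) w - y k u w - h * Z k w.
(* What the defect misses of the homogeneous equation with coefficients [B (u + h)]:
   a second order Taylor remainder and [h] times an increment of [B]. *)
pose err h k w := \sum_j (B k j (u + h) w - B k j u w - h * Bu k j u w) * y j u w
  + h * \sum_j (B k j (u + h) w - B k j u w) * Z j w.
have errC h k w : U (u + h) -> V w -> `|err h k w| <= C * `|h| ^+ 2.
  move=> Uh Vw; rewrite /err; apply: le_trans (ler_normD _ _) _.
  have e1 j : `|B k j (u + h) w - B k j u w - h * Bu k j u w| <= M * `|h| ^+ 2.
    have := taylor2_bound (f := fun s => B k j s w) (f' := fun s => Bu k j s w)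
      (fun s Us => Bud k j Us Vw) (fun s Us => Buud k j Us Vw)
      (fun s Us => BuuM k j Us Vw) Uu Uh.
    by have -> : u + h - u = h by ring.
  have e2 j : `|B k j (u + h) w - B k j u w| <= M * `|h|.
    have := mean_value_bound (f := fun s => B k j s w) (df := fun s => Bu k j s w)
      (fun s Us => Bud k j Us Vw) (fun s Us => BuM k j Us Vw) Uu Uh.
    by have -> : u + h - u = h by ring.
  have := sum_mul_bound e1 (fun j => yK j w Vw).
  have := sum_mul_bound e2 (fun j => ZK j w Vw).
  rewrite normrM; set a := `|\sum_j _|; set b := `|\sum_j _| => ha hb.
  have := ler_wpM2l (normr_ge0 h) ha; rewrite /C; lra.
have defect_sol h : U (u + h) ->
    solves (fun i k => B i k (u + h)) (defect h) (err h) v0 r.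
  move=> Uh k w Vw.
  pose dZ := \sum_j (Av k j u w * y j u w + A k j u w * \sum_l B j l u w * y l u w).
  have Zd : is_derive w 1 (Z k) dZ.
    apply: (is_derive1_sum (df := fun j w => Av k j u w * y j u w +
      A k j u w * \sum_l B j l u w * y l u w)) => j.
    by apply: is_derive1M; [apply: Avd | apply: yv].
  have y1 := yv k u w Uu Vw; have y2 := yv k (u + h) w Uh Vw.
  have dZE : dZ = \sum_j Bu k j u w * y j u w + \sum_j B k j u w * Z j w.
    have swap D E : \sum_j D k j u w * (\sum_l E j l u w * y l u w) =
        \sum_l (\sum_j D k j u w * E j l u w) * y l u w.
      under eq_bigr do rewrite mulr_sumr; rewrite exchange_big /=.
      by apply: eq_bigr => l _; rewrite mulr_suml; apply: eq_bigr => j _; rewrite mulrA.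
    rewrite /dZ /Z big_split /= !swap -!big_split /=.
    by apply: eq_bigr => j _; rewrite -!mulrDl compat.
  have -> : \sum_j B k j (u + h) w * defect h j w + err h k w =
      \sum_j B k j (u + h) w * y j (u + h) w - \sum_j B k j u w * y j u w - h * dZ.
    rewrite dZE /err /defect mulrDr !mulr_sumr -!sumrB -!big_split /= -!sumrB.
    by apply: eq_bigr => j _; ring.
  have hZ := is_derive1M (is_derive_cst h w 1) Zd.
  rewrite mul0r add0r in hZ.
  exact: is_deriveB (is_deriveB y2 y1) hZ.
apply/is_derive1P => eps eps0.
have C0 : 0 <= C.
  have M0 := le_trans (normr_ge0 _) (AM i i Uu Vv).
  have K0 := le_trans (normr_ge0 _) (yK i v Vv).
  have nM0 : 0 <= n%:R * M by apply: mulr_ge0.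
  have nMK := mulr_ge0 nM0 K0.
  exact: addr_ge0 nMK (mulr_ge0 nM0 nMK).
have rC0 : 0 <= 2 * r * C by rewrite mulr_ge0 ?mulr_ge0 ?(ltW r0).
near=> h.
have Uh : U (u + h).
  rewrite /U; apply: (@le_lt_trans _ _ (`|u - u0| + `|h|)).
    by rewrite addrAC ler_normD.
  rewrite -ltrBrDl; near: h; exists (r - `|u - u0|); first by rewrite /= subr_gt0.
  by move=> h /=; rewrite sub0r normrN.
have D0 : forall k, `|defect h k v0| <= eps / 4 * `|h|.
  move=> k; rewrite /defect !yP//.
  have -> : Z k v0 = \sum_j A k j u v0 * P j u.
    by apply: eq_bigr => j _; rewrite yP.
  move: k; near: h; apply: filter_forall => k.
  have := Psol k u Uu; rewrite addr0 => /is_derive1P; apply.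
  by rewrite divr_gt0.
have := linear_ode_bound nMr (fun i k w Vw => BM i k Uh Vw)
  (fun i w Vw => errC h i w Uh Vw) D0 (defect_sol h Uh) i Vv.
move=> /le_trans; apply.
have hC : 2 * r * C * `|h| <= eps / 2.
  have hd : `|h| <= eps / 2 / (2 * r * C + 1).
    near: h; exists (eps / 2 / (2 * r * C + 1)) => [|h /=].
      by rewrite /= divr_gt0 ?divr_gt0 ?ltr_wpDl.
    by rewrite sub0r normrN => /ltW.
  apply: (@le_trans _ _ ((2 * r * C + 1) * `|h|)).
    by rewrite ler_wpM2r// lerDl.
  by rewrite mulrC -ler_pdivlMr ?ltr_wpDl.
have := ler_wpM2r (normr_ge0 h) hC; rewrite expr2; lra.
Unshelve. all: by end_near. Qed.

End Square.

End TotalSystem.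

(** * Partial derivatives and smoothness on the plane *)

Section Plane.
Context {R : realType}.
Implicit Types (D : set (R * R)) (p q : R * R).

Lemma is_deriveE (V : normedModType R) (f : R * R -> V) p w df :
  is_derive p w f df -> 'D_w f p = df.
Proof. by case. Qed.

Lemma is_derive_u (V : normedModType R) (f : R * R -> V) p df :
  is_derive p (1, 0) f df <-> is_derive p.1 1 (fun s => f (s, p.2)) df.
Proof.
have E : (fun h : R => h^-1 *: ((f \o shift p) (h *: (1, 0)) - f p)) =
    (fun h : R => h^-1 *: (((fun s => f (s, p.2)) \o shift p.1) (h *: 1) - f (p.1, p.2))).
  apply/funext => h; case: p => a b /=; congr (_ *: (f _ - _)).
  by congr (_, _); rewrite /= [h *: 0]mulr0 add0r.
by split => -[dp dE]; split; move: dp dE; rewrite /derivable /derive E.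
Qed.

Lemma is_derive_v (V : normedModType R) (f : R * R -> V) p df :
  is_derive p (0, 1) f df <-> is_derive p.2 1 (fun s => f (p.1, s)) df.
Proof.
have E : (fun h : R => h^-1 *: ((f \o shift p) (h *: (0, 1)) - f p)) =
    (fun h : R => h^-1 *: (((fun s => f (p.1, s)) \o shift p.2) (h *: 1) - f (p.1, p.2))).
  apply/funext => h; case: p => a b /=; congr (_ *: (f _ - _)).
  by congr (_, _); rewrite /= [h *: 0]mulr0 add0r.
by split => -[dp dE]; split; move: dp dE; rewrite /derivable /derive E.
Qed.

Lemma eq_on_near (T : Type) D (f g : R * R -> T) p : open D -> D p ->
  (forall q, D q -> f q = g q) -> \near p, f p = g p.
Proof. by move=> oD Dp fg; near=> q; apply: fg; near: q; apply: open_nbhs_nbhs.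
Unshelve. all: by end_near. Qed.

Lemma is_derive_on (V : normedModType R) D (f g : R * R -> V) p w df :
  open D -> D p -> (forall q, D q -> f q = g q) ->
  is_derive p w f df -> is_derive p w g df.
Proof. by move=> oD Dp fg; apply: near_eq_is_derive; apply: eq_on_near fg. Qed.

Lemma derive_on (V : normedModType R) D (f g : R * R -> V) p w :
  open D -> D p -> (forall q, D q -> f q = g q) -> 'D_w f p = 'D_w g p.
Proof. by move=> oD Dp fg; apply: near_eq_derive; apply: eq_on_near fg. Qed.

Definition square p0 (r : R) := [set p : R * R | `|p.1 - p0.1| < r /\ `|p.2 - p0.2| < r].

Lemma squareE p0 r : square p0 r = ball p0 r.
Proof.
apply/seteqP; split=> p; rewrite -ball_normE /ball_ /square /= prod_normE gt_max.
  by rewrite (distrC p.1) (distrC p.2) => -[h1 h2]; apply/andP.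
by move=> /andP[h1 h2]; rewrite (distrC p.1) (distrC p.2).
Qed.

Lemma square_open p0 r : open (square p0 r).
Proof. by rewrite squareE; exact: ball_open. Qed.

Lemma square_center p0 r : 0 < r -> square p0 r p0.
Proof. by move=> r0; split; rewrite subrr normr0. Qed.

Lemma near_square p0 r p : square p0 r p -> \forall q \near p, square p0 r q.
Proof. by move=> Sp; apply: open_nbhs_nbhs; split=> //; exact: square_open. Qed.

Lemma square_connected p0 r : connected (square p0 r).
Proof.
pose seg q (t : R) : R * R := (p0.1 + t * (q.1 - p0.1), p0.2 + t * (q.2 - p0.2)).
have scale (x a t : R) : 0 <= t <= 1 -> `|x - a| < r -> `|a + t * (x - a) - a| < r.
  move=> /andP[t0 t1] xr; rewrite addrAC subrr add0r normrM (ger0_norm t0).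
  by apply: le_lt_trans xr; rewrite ler_piMl.
have -> : square p0 r = \bigcup_(q in square p0 r) (seg q @` `[0, 1]).
  apply/seteqP; split=> [q Sq|q [q' [Sx Sy] [t]]].
    exists q => //; exists 1; first by rewrite /= in_itv /= ler01 lexx.
    by rewrite /seg !mul1r ![_ + (_ - _)]addrC !subrK; case: q {Sq}.
  by rewrite /= in_itv /= => t01 <-; split; apply: scale.
apply: bigcup_connected.
  exists p0 => q _; exists 0; first by rewrite /= in_itv /= lexx ler01.
  by rewrite /seg !mul0r !addr0; case: p0 {seg scale q}.
move=> q _; apply: connected_continuous_connected; first exact: segment_connected.
apply: continuous_subspaceT => t.
have aff (a b : R) : {for t, continuous (fun s : R => a + s * b)}.
  by apply: cvgD; [exact: cvg_cst | apply: cvgMl; exact: cvg_id].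
exact: cvg_pair (aff _ _) (aff _ _).
Qed.

(** Boundedness of the partial derivatives makes a function Lipschitz. *)
Lemma continuous_of_bounded_partials (f fu fv : R * R -> R) p0 r C :
  (forall p, square p0 r p -> is_derive p (1, 0) f (fu p) /\ is_derive p (0, 1) f (fv p)) ->
  (forall p, square p0 r p -> `|fu p| <= C /\ `|fv p| <= C) ->
  forall p, square p0 r p -> {for p, continuous f}.
Proof.
move=> fd fC p Sp; have C0 : 0 <= C by apply: le_trans (fC p Sp).1.
have lip q : square p0 r q -> `|f q - f p| <= C * (`|q.1 - p.1| + `|q.2 - p.2|).
  move=> Sq; have Sx : square p0 r (q.1, p.2) by split; [apply: Sq.1 | apply: Sp.2].
  rewrite -(subrKA (f (q.1, p.2))) mulrDr addrC.
  apply: le_trans (ler_normD _ _) _; apply: lerD.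
    have := mean_value_bound (f := fun s => f (s, p.2)) (df := fun s => fu (s, p.2))
      _ _ Sp.1 Sq.1.
    rewrite -surjective_pairing; apply => s Ss; last by apply: (fC (s, p.2) _).1; split=> //; case: Sp.
    by have /is_derive_u := (fd (s, p.2) (conj Ss Sp.2)).1.
  have := mean_value_bound (f := fun s => f (q.1, s)) (df := fun s => fv (q.1, s))
    _ _ Sp.2 Sq.2.
  rewrite -surjective_pairing; apply => s Ss; last by apply: (fC (q.1, s) _).2; split=> //; case: Sq.
  by have /is_derive_v := (fd (q.1, s) (conj Sq.1 Ss)).2.
apply/cvgrPdist_lt => eps eps0.
have C2 : 0 < 2 * C + 1 by rewrite ltr_wpDl// mulr_ge0.
near=> q.
have Sq : square p0 r q by near: q; exact: near_square.
have [q1 q2] : square p (eps / (2 * C + 1)) q.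
  by near: q; apply/near_square/square_center; rewrite divr_gt0.
rewrite distrC; apply: le_lt_trans (lip q Sq) _.
move: q1 q2; rewrite !ltr_pdivlMr// => q1 q2.
have := normr_ge0 (q.1 - p.1); have := normr_ge0 (q.2 - p.2); nra.
Unshelve. all: by end_near. Qed.

(** The left-hand side is unchanged when the two variables are exchanged; applied in
    both orders this gives the symmetry of continuous mixed derivatives. *)
Lemma second_difference (f fu fuv : R -> R -> R) (u0 v0 r h : R) :
  `|h| < r ->
  (forall u v, `|u - u0| < r -> `|v - v0| < r -> is_derive u 1 (fun s => f s v) (fu u v)) ->
  (forall u v, `|u - u0| < r -> `|v - v0| < r -> is_derive v 1 (fu u) (fuv u v)) ->
  exists u v, [/\ `|u - u0| < r, `|v - v0| < r &
    (f (u0 + h) (v0 + h) - f (u0 + h) v0) - (f u0 (v0 + h) - f u0 v0) =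
    h ^+ 2 * fuv u v].
Proof.
move=> hr fd fud; have r0 : 0 < r by apply: le_lt_trans hr.
have c0 (x : R) : `|x - x| < r by rewrite subrr normr0.
have ch x : `|x + h - x| < r by rewrite addrAC subrr add0r.
have [u ur [_ E]] := mvt_ball (f := fun s => f s (v0 + h) - f s v0)
  (fun s sr => is_deriveB (fd s (v0 + h) sr (ch v0)) (fd s v0 sr (c0 v0)))
  (c0 u0) (ch u0).
have [v vr [_ F]] := mvt_ball (fun s sr => fud u s ur sr) (c0 v0) (ch v0).
exists u, v; split=> //; rewrite E F; ring.
Qed.

Lemma schwarz D (f fu fv fuv fvu : R * R -> R) p : open D -> D p ->
  (forall q, D q -> is_derive q (1, 0) f (fu q) /\ is_derive q (0, 1) f (fv q)) ->
  (forall q, D q -> is_derive q (0, 1) fu (fvu q)) ->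
  (forall q, D q -> is_derive q (1, 0) fv (fuv q)) ->
  {for p, continuous fuv} -> {for p, continuous fvu} -> fuv p = fvu p.
Proof.
move=> oD Dp fd fud fvd c1 c2.
apply/eqP; rewrite -subr_eq0 -normr_le0; apply/ler_addgt0Pr => eps eps0; rewrite add0r.
have /cvgrPdist_lt/(_ (eps / 2)) := c1; rewrite divr_gt0// => /(_ isT) n1.
have /cvgrPdist_lt/(_ (eps / 2)) := c2; rewrite divr_gt0// => /(_ isT) n2.
have [r r0 rP] : exists2 r, 0 < r & forall q, square p r q -> [/\ D q,
    `|fuv p - fuv q| < eps / 2 & `|fvu p - fvu q| < eps / 2].
  have : \forall q \near p, [/\ D q,
    `|fuv p - fuv q| < eps / 2 & `|fvu p - fvu q| < eps / 2].
    by apply: filterS3 (open_nbhs_nbhs (conj oD Dp)) n1 n2 => q.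
  by move=> /nbhs_ballP[r r0 H]; exists r => // q; rewrite squareE; apply: H.
have SD u v : `|u - p.1| < r -> `|v - p.2| < r -> D (u, v).
  by move=> ur vr; have [] := rP (u, v) (conj ur vr).
have hr : `|r / 2| < r by rewrite gtr0_norm ?divr_gt0//; lra.
have [||u [v [ur vr E]]] := @second_difference (fun u v => f (u, v))
    (fun u v => fu (u, v)) (fun u v => fvu (u, v)) p.1 p.2 r (r / 2) hr.
- by move=> u v ur vr; apply/(is_derive_u f (u, v)); case: (fd _ (SD u v ur vr)).
- by move=> u v ur vr; apply/(is_derive_v fu (u, v))/fud/SD.
have [||v' [u' [vr' ur' F]]] := @second_difference (fun v u => f (u, v))
    (fun v u => fv (u, v)) (fun v u => fuv (u, v)) p.2 p.1 r (r / 2) hr.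
- by move=> v' u' vr' ur'; apply/(is_derive_v f (u', v')); case: (fd _ (SD u' v' ur' vr')).
- by move=> v' u' vr' ur'; apply/(is_derive_u fv (u', v'))/fvd/SD.
have [_ _ e1] := rP (u, v) (conj ur vr); have [_ e2 _] := rP (u', v') (conj ur' vr').
have EF : fuv (u', v') = fvu (u, v).
  have r2 : (r / 2) ^+ 2 != 0 by rewrite expf_neq0// gt_eqF// divr_gt0.
  by apply: (mulfI r2); rewrite -E -F; ring.
move: e1 e2; rewrite EF !ltr_norml ler_norml => /andP[? ?] /andP[? ?].
by apply/andP; split; lra.
Unshelve. all: by end_near. Qed.

Lemma smooth_on_du (V : normedModType R) D (f : R * R -> V) : smooth_on D f -> smooth_on D (du f).
Proof.
move=> fs w p Dp; have := fs (rcons w true) p Dp.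
by rewrite /iter_partial foldr_rcons.
Qed.

Lemma smooth_on_dv (V : normedModType R) D (f : R * R -> V) : smooth_on D f -> smooth_on D (dv f).
Proof.
move=> fs w p Dp; have := fs (rcons w false) p Dp.
by rewrite /iter_partial foldr_rcons.
Qed.

Definition has_partials (V : normedModType R) D (f fu fv : R * R -> V) :=
  forall p, D p -> [/\ {for p, continuous f},
    is_derive p (1, 0) f (fu p) & is_derive p (0, 1) f (fv p)].

(** The derivatives are only required to agree on [D] with members of [P], since
    nothing is known about them elsewhere. *)
Definition diff_closed (V : normedModType R) D (P : (R * R -> V) -> Prop) :=
  forall f, P f -> exists fu fv, [/\ P fu, P fv & has_partials D f fu fv].

Lemma smooth_has_partials (V : normedModType R) D (f : R * R -> V) :
  smooth_on D f -> has_partials D f (du f) (dv f).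
Proof. by move=> fs p Dp; have [c du1 dv1] := fs [::] p Dp; split=> //; apply: derivableP. Qed.

(** By induction on the word [w], the derivative [iter_partial w f] agrees on [D] with a
    member of [P]; as [D] is open, the agreement survives one more derivation. *)
Lemma diff_closed_smooth (V : normedModType R) D (P : (R * R -> V) -> Prop) f :
  open D -> diff_closed D P -> P f -> smooth_on D f.
Proof.
move=> oD Pd Pf.
have H w : exists2 g, P g & forall p, D p -> iter_partial w f p = g p.
  elim: w => [|b w [g Pg wg]]; first by exists f.
  have [gu [gv [Pu Pv gd]]] := Pd g Pg.
  exists (if b then gu else gv); first by case: b.
  move=> p Dp; have [_ d1 d2] := gd p Dp.
  by case: b; rewrite /= /du /dv (derive_on _ oD Dp wg); apply: derive_val.
move=> w p Dp; have [g Pg wg] := H w; have [gu [gv [_ _ /(_ p Dp)[gc d1 d2]]]] := Pd g Pg.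
have gw q : D q -> g q = iter_partial w f q by move=> /wg.
split; last 2 first.
- by case: (is_derive_on oD Dp gw d1).
- by case: (is_derive_on oD Dp gw d2).
suff : iter_partial w f @ p --> g p by rewrite -(wg p Dp).
apply: cvg_trans gc; apply: near_eq_cvg.
exact: eq_on_near gw.
Qed.

Lemma smooth_on_subset (V : normedModType R) D D' (f : R * R -> V) :
  D' `<=` D -> smooth_on D f -> smooth_on D' f.
Proof. by move=> DD fs w p /DD; apply: fs. Qed.

Inductive alg (T : (R * R -> R) -> Prop) : (R * R -> R) -> Prop :=
| alg_gen f : T f -> alg T f
| alg_cst (c : R) : alg T (cst c)
| alg_add f g : alg T f -> alg T g -> alg T (fun p => f p + g p)
| alg_mul f g : alg T f -> alg T g -> alg T (fun p => f p * g p).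

Lemma alg_sum T n (F : 'I_n -> R * R -> R) :
  (forall k, alg T (F k)) -> alg T (fun p => \sum_k F k p).
Proof.
elim: n F => [F _|n IH F HF].
  by have -> : (fun p => \sum_k F k p) = cst 0;
    [apply/funext => p; rewrite big_ord0 | apply: alg_cst].
have -> : (fun p => \sum_k F k p) =
    (fun p => (\sum_(k < n) F (widen_ord (leqnSn n) k) p) + F ord_max p).
  by apply/funext => p; rewrite big_ord_recr.
by apply: alg_add => //; apply: IH.
Qed.

(** By the Leibniz rule, it suffices to differentiate the generators. *)
Lemma alg_diff_closed D (T : (R * R -> R) -> Prop) :
  (forall f, T f -> exists fu fv, [/\ alg T fu, alg T fv & has_partials D f fu fv]) ->
  diff_closed D (alg T).
Proof.
move=> HT f; elim=> {f} [//|c|f g Tf [fu [fv [Tfu Tfv fd]]] Tg [gu [gv [Tgu Tgv gd]]]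
  |f g Tf [fu [fv [Tfu Tfv fd]]] Tg [gu [gv [Tgu Tgv gd]]]].
- exists (cst 0), (cst 0); split; [exact: alg_cst..|].
  by move=> p _; split; [exact: cst_continuous|exact: is_derive_cst..].
- exists (fun p => fu p + gu p), (fun p => fv p + gv p); split; [exact: alg_add..|].
  move=> p Dp; have [[fc f1 f2] [gc g1 g2]] := (fd p Dp, gd p Dp).
  by split; [exact: cvgD|exact: is_deriveD..].
- exists (fun p => fu p * g p + f p * gu p), (fun p => fv p * g p + f p * gv p).
  split; [by apply: alg_add; apply: alg_mul..|].
  move=> p Dp; have [[fc f1 f2] [gc g1 g2]] := (fd p Dp, gd p Dp).
  have M w a b : is_derive p w f a -> is_derive p w g b ->
      is_derive p w (fun q => f q * g q) (a * g p + f p * b).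
    move=> fa gb; apply: is_derive_eq (is_deriveM fa gb) _.
    by rewrite /GRing.scale /= addrC; congr (_ + _); apply: mulrC.
  by split; [exact: cvgM|exact: M..].
Qed.

(** The bootstrap by which solutions of differential systems become smooth: once the
    first derivatives of the members of [T] are polynomials in [T] with smooth
    coefficients, so are all the others. *)
Lemma smooth_extension D (T : (R * R -> R) -> Prop) f : open D ->
  let P := alg (fun g => T g \/ smooth_on D g) in
  (forall f, T f -> exists fu fv, [/\ P fu, P fv & has_partials D f fu fv]) ->
  P f -> smooth_on D f.
Proof.
move=> oD P HT; apply: diff_closed_smooth oD _; apply: alg_diff_closed.
move=> g [/HT//|gs]; exists (du g), (dv g); split; last exact: smooth_has_partials.
  by apply: alg_gen; right; apply: smooth_on_du.
by apply: alg_gen; right; apply: smooth_on_dv.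
Qed.

Lemma alg_smooth D f : open D -> alg (smooth_on D) f -> smooth_on D f.
Proof.
move=> oD; apply: diff_closed_smooth oD _; apply: alg_diff_closed => g gs.
exists (du g), (dv g); split; last exact: smooth_has_partials.
  by apply/alg_gen/smooth_on_du.
by apply/alg_gen/smooth_on_dv.
Qed.

Lemma smooth_on_mul D (f g : R * R -> R) : open D -> smooth_on D f -> smooth_on D g ->
  smooth_on D (fun p => f p * g p).
Proof. by move=> oD fs gs; apply: alg_smooth oD _; apply: alg_mul; apply: alg_gen. Qed.

Lemma is_derive_mxP n (L : R * R -> 'rV[R]_n) p w dL :
  is_derive p w L dL <-> forall i, is_derive p w (fun q => L q 0 i) (dL 0 i).
Proof.
split=> [[dp dE] i|H].
  apply: DeriveDef; first by have /derivable_mxP := dp; apply.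
  by rewrite -dE derive_mx// mxE.
have dp : derivable L p w by apply/derivable_mxP => i j; rewrite ord1; case: (H j).
apply: DeriveDef => //; apply/rowP => i.
by rewrite derive_mx// mxE; apply: derive_val.
Qed.

Lemma continuous_rowP n (L : R * R -> 'rV[R]_n) p :
  {for p, continuous L} <-> forall i, {for p, continuous (fun q => L q 0 i)}.
Proof.
split=> [Lc i|H].
  apply: (@continuous_comp _ _ _ L (fun M : 'rV[R]_n => M 0 i) p Lc).
  exact: coord_continuous.
apply/cvgrPdist_le => eps eps0; near=> q.
rewrite [leLHS]/Num.Def.normr/= mx_normrE (bigmax_le _ (ltW eps0))//= => -[i j] _.
rewrite !mxE ord1 /=; move: j; near: q; apply: filter_forall => j.
by have /cvgrPdist_le := H j; apply.
Unshelve. all: by end_near. Qed.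

Lemma smooth_rowP n D (L : R * R -> 'rV[R]_n) : open D ->
  smooth_on D L <-> forall i, smooth_on D (fun q => L q 0 i).
Proof.
move=> oD; split=> [Ls i|].
  pose P (g : R * R -> R) := exists2 K : R * R -> 'rV[R]_n, smooth_on D K & g = fun q => K q 0 i.
  apply: (@diff_closed_smooth _ D P) => //; last by exists L.
    move=> _ [K Ks ->]; exists (fun q => du K q 0 i), (fun q => dv K q 0 i).
    split; [by exists (du K); first exact: smooth_on_du
           |by exists (dv K); first exact: smooth_on_dv|].
    move=> p Dp; have [/continuous_rowP Kc /is_derive_mxP K1 /is_derive_mxP K2] :=
      smooth_has_partials Ks Dp.
    by split.
move=> Ls; pose P (K : R * R -> 'rV[R]_n) := forall i, smooth_on D (fun q => K q 0 i).
apply: (@diff_closed_smooth _ D P) => // {L Ls}.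
move=> K Ks; pose Ku q := \row_i du (fun q => K q 0 i) q.
pose Kv q := \row_i dv (fun q => K q 0 i) q.
exists Ku, Kv; split=> [i|i|].
- have -> : (fun q => Ku q 0 i) = du (fun q => K q 0 i) by apply/funext => q; rewrite mxE.
  exact: smooth_on_du.
- have -> : (fun q => Kv q 0 i) = dv (fun q => K q 0 i) by apply/funext => q; rewrite mxE.
  exact: smooth_on_dv.
move=> p Dp; split.
- by apply/continuous_rowP => i; case: (smooth_has_partials (Ks i) Dp).
- by apply/is_derive_mxP => i; rewrite mxE; case: (smooth_has_partials (Ks i) Dp).
- by apply/is_derive_mxP => i; rewrite mxE; case: (smooth_has_partials (Ks i) Dp).
Qed.

Lemma mixed_partials_eq n D (L : R * R -> 'rV[R]_n) p : open D -> D p -> smooth_on D L ->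
  du (dv L) p = dv (du L) p.
Proof.
move=> oD Dp Ls; apply/rowP => i.
have [/continuous_rowP c1 _ _] := smooth_has_partials (smooth_on_du (smooth_on_dv Ls)) Dp.
have [/continuous_rowP c2 _ _] := smooth_has_partials (smooth_on_dv (smooth_on_du Ls)) Dp.
apply: (@schwarz D (fun q => L q 0 i) (fun q => du L q 0 i) (fun q => dv L q 0 i)
  (fun q => du (dv L) q 0 i) (fun q => dv (du L) q 0 i) p oD Dp _ _ _ (c1 i) (c2 i)) => q Dq.
- by have [_ /is_derive_mxP h1 /is_derive_mxP h2] := smooth_has_partials Ls Dq.
- by have [_ _ /is_derive_mxP h] := smooth_has_partials (smooth_on_du Ls) Dq.
- by have [_ /is_derive_mxP h _] := smooth_has_partials (smooth_on_dv Ls) Dq.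
Qed.

End Plane.

(** * Integrable smooth systems near a point *)

Section SmoothSystem.
Context {R : realType} (n : nat).
Implicit Types (D S : set (R * R)) (p : R * R)
  (A B : 'I_n -> 'I_n -> R * R -> R) (y : 'I_n -> R * R -> R).

Definition solves_total S A B y := forall i p, S p ->
  is_derive p (1, 0) (y i) (\sum_k A i k p * y k p) /\
  is_derive p (0, 1) (y i) (\sum_k B i k p * y k p).

Lemma smooth_locally_bounded D (f : 'I_n -> 'I_n -> R * R -> R) p0 :
  D p0 -> (forall i k, smooth_on D (f i k)) ->
  exists M, \forall p \near p0, forall i k, `|f i k p| <= M.
Proof.
move=> Dp0 fs; exists (\sum_i \sum_k (`|f i k p0| + 1)).
set M := \sum_i _; suff H i k : \forall p \near p0, `|f i k p| <= M.
  apply: (@filter_forall _ _ (fun i p => forall k, `|f i k p| <= M)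
    (nbhs p0) (nbhs_filter p0)) => i.
  apply: (@filter_forall _ _ (fun k p => `|f i k p| <= M) (nbhs p0) (nbhs_filter p0)).
  exact: (H i).
have [fc _ _] := smooth_has_partials (fs i k) Dp0.
have /cvgrPdist_le/(_ _ ltr01) := fc; apply: filterS => p h.
have pos j m : 0 <= `|f j m p0| + 1 by rewrite addr_ge0.
apply: (@le_trans _ _ (`|f i k p0| + 1)).
  rewrite -(subrK (f i k p0) (f i k p)) addrC; apply: le_trans (ler_normD _ _) _.
  by rewrite lerD2l distrC.
apply: le_trans (le_sum_term i (fun j => sumr_ge0 _ (fun m _ => pos j m))).
exact: (le_sum_term (K := fun m => `|f i m p0| + 1)).
Qed.

Lemma solves_total_smooth D A B y p0 r :
  square p0 r `<=` D -> (forall i k, smooth_on D (A i k)) -> (forall i k, smooth_on D (B i k)) ->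
  (forall i p, square p0 r p -> {for p, continuous (y i)}) ->
  solves_total (square p0 r) A B y -> forall i, smooth_on (square p0 r) (y i).
Proof.
move=> SD As Bs yc ysol i; set S := square p0 r.
apply: (@smooth_extension R S (fun g => exists j, g = y j)); first exact: square_open.
  move=> _ [j ->]; exists (fun p => \sum_k A j k p * y k p), (fun p => \sum_k B j k p * y k p).
  split; last by move=> p Sp; have [] := ysol j p Sp; split; first exact: yc.
    apply: alg_sum => k; apply: alg_mul; apply: alg_gen; last by left; exists k.
    by right; apply: smooth_on_subset SD _.
  apply: alg_sum => k; apply: alg_mul; apply: alg_gen; last by left; exists k.
  by right; apply: smooth_on_subset SD _.
by apply: alg_gen; left; exists i.
Qed.

(** Only local bounds for the coefficients determine the radius; by linearity it does
    not depend on the initial value. *)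
Lemma smooth_frobenius D A B p0 : open D -> D p0 ->
  (forall i k, smooth_on D (A i k)) -> (forall i k, smooth_on D (B i k)) ->
  (forall i k p, D p -> dv (A i k) p + \sum_j A i j p * B j k p =
                        du (B i k) p + \sum_j B i j p * A j k p) ->
  exists r, [/\ 0 < r, square p0 r `<=` D,
    forall y0 : 'I_n -> R, exists y, [/\ forall i, y i p0 = y0 i,
      forall i, smooth_on (square p0 r) (y i) & solves_total (square p0 r) A B y] &
    forall y, solves_total (square p0 r) A B y -> (forall i, y i p0 = 0) ->
      forall i p, square p0 r p -> y i p = 0].
Proof.
move=> oD Dp0 As Bs compat.
have [M1 near1] := smooth_locally_bounded Dp0 As.
have [M2 near2] := smooth_locally_bounded Dp0 Bs.
have Bus i k := smooth_on_du (Bs i k); have Buus i k := smooth_on_du (Bus i k).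
have [M3 near3] := smooth_locally_bounded Dp0 Bus.
have [M4 near4] := smooth_locally_bounded Dp0 Buus.
pose M := `|M1| + `|M2| + `|M3| + `|M4|.
have [rho rho0 rhoP] : exists2 rho, 0 < rho & forall p, square p0 rho p -> D p /\
    forall i k, [/\ `|A i k p| <= M, `|B i k p| <= M, `|du (B i k) p| <= M
                  & `|du (du (B i k)) p| <= M].
  have both P Q := @filterI _ _ (nbhs_filter p0) P Q.
  have := both _ _ (open_nbhs_nbhs (conj oD Dp0))
    (both _ _ (both _ _ near1 near2) (both _ _ near3 near4)).
  move=> /nbhs_ballP[rho rho0 H]; exists rho => // p; rewrite squareE => /H.
  case=> Dp [[h1 h2] [h3 h4]]; split=> // i k; rewrite /M.
  have a1 := ler_norm M1; have a2 := ler_norm M2; have a3 := ler_norm M3.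
  have a4 := ler_norm M4; have b1 := normr_ge0 M1; have b2 := normr_ge0 M2.
  have b3 := normr_ge0 M3; have b4 := normr_ge0 M4.
  by split; [apply: le_trans (h1 i k) _|apply: le_trans (h2 i k) _
    |apply: le_trans (h3 i k) _|apply: le_trans (h4 i k) _]; lra.
have M0 : 0 <= M by rewrite /M !addr_ge0.
have nM0 : 0 <= n%:R * M by rewrite mulr_ge0.
(* The second term makes [n * M * r <= 1/2]. *)
pose r := Num.min rho (2 * (n%:R * M + 1))^-1.
have nM1 : 0 < 2 * (n%:R * M + 1) by rewrite mulr_gt0// ltr_wpDl.
have r0 : 0 < r by rewrite lt_min rho0 invr_gt0.
have nMr : n%:R * M * r <= 2^-1.
  apply: (@le_trans _ _ (n%:R * M * (2 * (n%:R * M + 1))^-1)).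
    by rewrite ler_wpM2l// ge_min lexx orbT.
  by rewrite ler_pdivrMr// mulrA mulVf ?pnatr_eq0// mul1r lerDl.
have Srho p : square p0 r p -> square p0 rho p.
  by move=> [h1 h2]; split; [move: h1|move: h2]; rewrite lt_min => /andP[].
have SD : square p0 r `<=` D by move=> p /Srho/rhoP[].
have inS u v : `|u - p0.1| < r -> `|v - p0.2| < r -> square p0 r (u, v) by [].
have bound u v : `|u - p0.1| < r -> `|v - p0.2| < r -> forall i k,
    [/\ `|A i k (u, v)| <= M, `|B i k (u, v)| <= M, `|du (B i k) (u, v)| <= M
      & `|du (du (B i k)) (u, v)| <= M].
  by move=> ur vr; have [] := rhoP (u, v) (Srho _ (inS u v ur vr)).
pose cur (f : 'I_n -> 'I_n -> R * R -> R) i k u v := f i k (u, v).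
have SDu u v : `|u - p0.1| < r -> `|v - p0.2| < r -> D (u, v).
  by move=> ur vr; apply: SD.
have derv f i k u v : (forall i k, smooth_on D (f i k)) -> `|u - p0.1| < r ->
    `|v - p0.2| < r -> is_derive v 1 (cur f i k u) (dv (f i k) (u, v)).
  move=> fs ur vr; apply/(is_derive_v (f i k) (u, v)).
  by case: (smooth_has_partials (fs i k) (SDu u v ur vr)).
have deru f i k u v : (forall i k, smooth_on D (f i k)) -> `|u - p0.1| < r ->
    `|v - p0.2| < r -> is_derive u 1 (fun s => cur f i k s v) (du (f i k) (u, v)).
  move=> fs ur vr; apply/(is_derive_u (f i k) (u, v)).
  by case: (smooth_has_partials (fs i k) (SDu u v ur vr)).
have AM i k u v : `|u - p0.1| < r -> `|v - p0.2| < r -> `|cur A i k u v| <= M.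
  by move=> ur vr; case: (bound u v ur vr i k).
have BM i k u v : `|u - p0.1| < r -> `|v - p0.2| < r -> `|cur B i k u v| <= M.
  by move=> ur vr; case: (bound u v ur vr i k).
have c0 (x : R) : `|x - x| < r by rewrite subrr normr0.
have totalE y : solves_total (square p0 r) A B y <->
    solves2 p0.1 p0.2 r (cur A) (cur B) (fun i u v => y i (u, v)).
  split=> ysol i.
    move=> u v ur vr; have [h1 h2] := ysol i (u, v) (inS u v ur vr).
    by split; [apply/(is_derive_u (y i) (u, v)) | apply/(is_derive_v (y i) (u, v))].
  move=> [u v] [/= ur vr]; have [h1 h2] := ysol i u v ur vr.
  by split; [apply/is_derive_u | apply/is_derive_v].
exists r; split=> // [y0|y /totalE ysol yp0 i [u v] [ur vr]]; last first.
  apply/eqP; rewrite -normr_le0 -[leRHS](mulr0 4).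
  apply: (solves2_bound (y := fun i u v => y i (u, v)) r0 nMr AM BM ysol) ur vr.
  by move=> j; rewrite -surjective_pairing yp0 normr0.
have [] := @solves2_exists R n p0.1 p0.2 r M (cur A) (cur B) (cur (fun i k => dv (A i k)))
  (cur (fun i k => du (B i k))) (cur (fun i k => du (du (B i k)))) r0 nMr AM BM _ _ _ _ _ _ _ _ y0.
- by move=> i k u ur; apply: derivable1_continuous (deru A i k u p0.2 As ur (c0 _)).
- by move=> i k u v ur vr; apply: derv.
- by move=> i k u v ur vr; apply: derivable1_continuous (derv B i k u v Bs ur vr).
- by move=> i k u v ur vr; apply: deru.
- by move=> i k u v ur vr; apply: (deru (fun i k => du (B i k))).
- by move=> i k u v ur vr; case: (bound u v ur vr i k).
- by move=> i k u v ur vr; case: (bound u v ur vr i k).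
- by move=> i k u v ur vr; apply: compat; apply: SDu.
move=> z z0 zsol; pose y i (p : R * R) := z i p.1 p.2.
have ysol : solves_total (square p0 r) A B y by apply/totalE.
have yK i p : square p0 r p -> `|y i p| <= 4 * (\sum_j `|y0 j|).
  case: p => u v [ur vr]; apply: (solves2_bound r0 nMr AM BM zsol) ur vr => j.
  by rewrite z0 (@le_sum_term _ _ (fun j => `|y0 j|)).
exists y; split=> //; apply: (solves_total_smooth SD As Bs _ ysol) => i p Sp.
apply: (continuous_of_bounded_partials (ysol i) _ Sp) => q Sq.
have qE : q = (q.1, q.2) by case: (q).
split; apply: sum_mul_bound => k; [|exact: yK| |exact: yK].
  by rewrite qE; apply: AM; case: Sq.
by rewrite qE; apply: BM; case: Sq.
Qed.

End SmoothSystem.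

(** * Orthonormal frames *)

Section Frames.
Context {R : realType}.
Implicit Types (p q w : R * R) (x y z : 'rV[R]_4).

Lemma dotvC x y : dotv x y = dotv y x.
Proof. by apply: eq_bigr => i _; rewrite mulrC. Qed.

Lemma dotvDl x y z : dotv (x + y) z = dotv x z + dotv y z.
Proof. by rewrite -big_split; apply: eq_bigr => i _; rewrite mxE mulrDl. Qed.

Lemma dotvZl (c : R) x y : dotv (c *: x) y = c * dotv x y.
Proof. by rewrite mulr_sumr; apply: eq_bigr => i _; rewrite mxE mulrA. Qed.

Lemma dotvNl x y : dotv (- x) y = - dotv x y.
Proof. by rewrite -scaleN1r dotvZl mulN1r. Qed.

Lemma dotvZr (c : R) x y : dotv x (c *: y) = c * dotv x y.
Proof. by rewrite dotvC dotvZl dotvC. Qed.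

Lemma is_derive_sum_mul n (f g : 'I_n -> R * R -> R) p w df dg :
  (forall i, is_derive p w (f i) (df i)) -> (forall i, is_derive p w (g i) (dg i)) ->
  is_derive p w (fun q => \sum_i f i q * g i q)
    (\sum_i (df i * g i p + f i p * dg i)).
Proof.
move=> fd gd; have -> : (fun q => \sum_i f i q * g i q) = \sum_i (f i * g i).
  by apply/funext => q; rewrite fct_sumE.
apply: is_derive_eq (is_derive_sum (fun i => is_deriveM (fd i) (gd i))) _.
apply: eq_bigr => i _.
by rewrite /GRing.scale /= addrC; congr (_ + _); apply: mulrC.
Qed.

Lemma is_derive_dotv (f g : R * R -> 'rV[R]_4) p w df dg :
  is_derive p w f df -> is_derive p w g dg ->
  is_derive p w (fun q => dotv (f q) (g q)) (dotv df (g p) + dotv (f p) dg).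
Proof.
move=> /is_derive_mxP fd /is_derive_mxP gd.
by apply: is_derive_eq (is_derive_sum_mul fd gd) _; rewrite big_split.
Qed.

Lemma is_derive_scale (c : R * R -> R) (f : R * R -> 'rV[R]_4) p w dc df :
  is_derive p w c dc -> is_derive p w f df ->
  is_derive p w (fun q => c q *: f q) (dc *: f p + c p *: df).
Proof.
move=> cd /is_derive_mxP fd; apply/is_derive_mxP => i.
have -> : (fun q => (c q *: f q) 0 i) = c * (fun q => f q 0 i).
  by apply/funext => q; rewrite mxE.
apply: is_derive_eq (is_deriveM cd (fd i)) _.
by rewrite !mxE /GRing.scale /= addrC; congr (_ + _); apply: mulrC.
Qed.

Definition orthonormal_frame (e : 'I_4 -> 'rV[R]_4) :=
  forall i j, dotv (e i) (e j) = (i == j)%:R.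

Lemma orthonormal_mxP (e : 'I_4 -> 'rV[R]_4) :
  orthonormal_frame e <-> (\matrix_i e i) *m (\matrix_i e i)^T = 1%:M.
Proof.
have E i j : ((\matrix_i e i) *m (\matrix_i e i)^T) i j = dotv (e i) (e j).
  by rewrite mxE; apply: eq_bigr => k _; rewrite !mxE.
split=> H; first by apply/matrixP => i j; rewrite E H mxE.
by move=> i j; rewrite -E H mxE.
Qed.

Lemma orthonormal_expansion (e : 'I_4 -> 'rV[R]_4) x :
  orthonormal_frame e -> x = \sum_j dotv x (e j) *: e j.
Proof.
move=> /orthonormal_mxP /mulmx1C eTe.
have := mulmx1 x; rewrite -eTe mulmxA => {1}<-.
apply/rowP => k; rewrite mxE summxE; apply: eq_bigr => j _.
by rewrite !mxE; congr (_ * _); apply: eq_bigr => i _; rewrite !mxE.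
Qed.

(** The infinitesimal rotation of an orthonormal frame is skew-symmetric, so that
    it is determined by its entries above the diagonal. *)
Lemma frame_equation (S : set (R * R)) (e : 'I_4 -> R * R -> 'rV[R]_4) p w
    (W : 'I_4 -> 'rV[R]_4) (A : 'I_4 -> 'I_4 -> R) :
  open S -> S p -> (forall q, S q -> orthonormal_frame (e ^~ q)) ->
  (forall i, is_derive p w (e i) (W i)) ->
  (forall i j, A i j = - A j i) ->
  (forall i j : 'I_4, (i < j)%N -> dotv (W i) (e j p) = A i j) ->
  forall i, W i = \sum_j A i j *: e j p.
Proof.
move=> oS Sp oe ed Askew upper i.
have skew j k : dotv (W j) (e k p) = - dotv (W k) (e j p).
  have d1 := is_derive_dotv (ed j) (ed k).
  have d2 : is_derive p w (fun q => dotv (e j q) (e k q)) 0.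
    apply: (is_derive_on (f := cst ((j == k)%:R : R)) oS Sp) (is_derive_cst _ _ _).
    by move=> q Sq; rewrite (oe q Sq).
  have := is_deriveE d1; rewrite (is_deriveE d2).
  by rewrite (dotvC (e j p)) => /esym/eqP; rewrite addr_eq0 => /eqP.
rewrite {1}(orthonormal_expansion (W i) (oe p Sp)); apply: eq_bigr => j _.
congr (_ *: _); have [ij|ji|ij] := ltngtP (i : nat) j.
- exact: upper.
- by rewrite skew upper// Askew opprK.
- have <- : i = j by apply: val_inj.
  have := skew i i; have := Askew i i; lra.
Qed.

Lemma zero_partials_constant (f : R * R -> R) p0 r :
  (forall p, square p0 r p -> is_derive p (1, 0) f 0 /\ is_derive p (0, 1) f 0) ->
  forall p, square p0 r p -> f p = f p0.
Proof.
move=> fd [u v] [/= ur vr]; have r0 : 0 < r by apply: le_lt_trans ur.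
have c0 (x : R) : `|x - x| < r by rewrite subrr normr0.
have zero (x y : R) (d : R) : `|y - x| <= 0 * d -> y = x.
  by rewrite mul0r normr_le0 subr_eq0 => /eqP.
transitivity (f (u, p0.2)).
  apply: zero; apply: (@mean_value_bound R (fun s => f (u, s)) (fun=> 0) p0.2 r 0) (c0 _) vr.
    move=> s sr; apply/(is_derive_v f (u, s)).
    have Ss : square p0 r (u, s) by [].
    by case: (fd _ Ss).
  by move=> s _; rewrite normr0.
rewrite [in RHS](surjective_pairing p0).
apply: zero; apply: (@mean_value_bound R (fun s => f (s, p0.2)) (fun=> 0) p0.1 r 0) (c0 _) ur.
  move=> s sr; apply/(is_derive_u f (s, p0.2)).
  have Ss : square p0 r (s, p0.2) by split; [|apply: c0].
  by case: (fd _ Ss).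
by move=> s _; rewrite normr0.
Qed.

(** The terms of the derivative of the product cancel in pairs.  For the columns of
    the matrix [Phi] of a moving frame this says that [Phi^T *m Phi] is constant, so
    that a frame which is orthonormal at one point is orthonormal everywhere. *)
Lemma skew_solutions_dot n (A B : 'I_n -> 'I_n -> R * R -> R)
    (y z : 'I_n -> R * R -> R) p0 r :
  (forall i j p, A i j p = - A j i p) -> (forall i j p, B i j p = - B j i p) ->
  solves_total (square p0 r) A B y -> solves_total (square p0 r) A B z ->
  forall p, square p0 r p -> \sum_i y i p * z i p = \sum_i y i p0 * z i p0.
Proof.
move=> Askew Bskew ysol zsol.
have zero (C : 'I_n -> 'I_n -> R) (a b : 'I_n -> R) : (forall i j, C i j = - C j i) ->
    \sum_i ((\sum_k C i k * a k) * b i + a i * \sum_k C i k * b k) = 0.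
  move=> Cskew; rewrite big_split /=.
  under eq_bigr do rewrite mulr_suml.
  rewrite exchange_big /= -big_split big1 //= => i _.
  rewrite mulr_sumr -big_split big1 //= => k _.
  by rewrite (Cskew k i); ring.
apply: (zero_partials_constant (f := fun p => \sum_i y i p * z i p)) => p Sp.
split.
- apply: is_derive_eq (zero (fun i k => A i k p) (y ^~ p) (z ^~ p) _) => //.
  exact: is_derive_sum_mul (fun i => (ysol i p Sp).1) (fun i => (zsol i p Sp).1).
- apply: is_derive_eq (zero (fun i k => B i k p) (y ^~ p) (z ^~ p) _) => //.
  exact: is_derive_sum_mul (fun i => (ysol i p Sp).2) (fun i => (zsol i p Sp).2).
Qed.

End Frames.

(** * The moving frame in canonical principal parameters *)

Section Coefficients.
Context {R : realType}.
Implicit Types (p q w : R * R).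

Definition o0 : 'I_4 := @Ordinal 4 0 isT.
Definition o1 : 'I_4 := @Ordinal 4 1 isT.
Definition o2 : 'I_4 := @Ordinal 4 2 isT.
Definition o3 : 'I_4 := @Ordinal 4 3 isT.

Lemma ord4_ind (P : 'I_4 -> Prop) : P o0 -> P o1 -> P o2 -> P o3 -> forall i, P i.
Proof.
move=> P0 P1 P2 P3 [[|[|[|[|//]]]] i4].
- by have -> : Ordinal i4 = o0 by apply: val_inj.
- by have -> : Ordinal i4 = o1 by apply: val_inj.
- by have -> : Ordinal i4 = o2 by apply: val_inj.
- by have -> : Ordinal i4 = o3 by apply: val_inj.
Qed.

Lemma ord4_lt_ind (P : 'I_4 -> 'I_4 -> Prop) :
  P o0 o1 -> P o0 o2 -> P o0 o3 -> P o1 o2 -> P o1 o3 -> P o2 o3 ->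
  forall i j : 'I_4, (i < j)%N -> P i j.
Proof. by move=> ? ? ? ? ? ?; apply: ord4_ind; apply: ord4_ind. Qed.

Lemma sum4 (V : nmodType) (F : 'I_4 -> V) :
  \sum_j F j = F o0 + F o1 + F o2 + F o3.
Proof.
rewrite !big_ord_recl big_ord0 addr0 !addrA.
by congr (F _ + F _ + F _ + F _); apply: val_inj.
Qed.

(** The generator of the rotations in the plane of the axes [m] and [n]. *)
Definition skew_unit (m n : 'I_4) (i j : 'I_4) : R :=
  ((i == m) && (j == n))%:R - ((i == n) && (j == m))%:R.

(** Derivational formulas of the frame [l, X, Y, N]: with [a = nu ^ (-1/2)] and
    [k = nu ^ (1/2)], the entry [b] is [sqrt E * gamma1] in the direction of [u] and
    [sqrt G * gamma2] in the direction of [v]. *)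
Definition coefU (a b k : R) i j : R :=
  a * skew_unit o0 o1 i j + b * skew_unit o1 o2 i j + k * skew_unit o1 o3 i j.
Definition coefV (a b k : R) i j : R :=
  a * skew_unit o0 o2 i j + b * skew_unit o1 o2 i j - k * skew_unit o2 o3 i j.

Lemma skew_unitN m n i j : skew_unit m n i j = - skew_unit m n j i.
Proof. by rewrite /skew_unit opprB andbC [(i == n) && _]andbC. Qed.

Lemma coefU_skew a b k i j : coefU a b k i j = - coefU a b k j i.
Proof. by rewrite /coefU 3!(skew_unitN _ _ i j); ring. Qed.

Lemma coefV_skew a b k i j : coefV a b k i j = - coefV a b k j i.
Proof. by rewrite /coefV 3!(skew_unitN _ _ i j); ring. Qed.

(** The Gauss equation is the only condition of integrability that is not an
    identity: the Codazzi equations are contained in the form of the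
    coefficients. *)
Lemma coef_compat (a k pu pv puu pvv : R) i j :
  a * k = 1 -> puu + pvv = a ^+ 2 - k ^+ 2 ->
  coefU (- pv * a) pvv (pv * k) i j
    + \sum_m coefU a pv k i m * coefV a (- pu) k m j =
  coefV (- pu * a) (- puu) (pu * k) i j
    + \sum_m coefV a (- pu) k i m * coefU a pv k m j.
Proof.
move=> ak gauss; rewrite !sum4 /coefU /coefV /skew_unit.
by move: i j; apply: ord4_ind; apply: ord4_ind; rewrite /=; lra.
Qed.

Lemma sum_coefU (V : lmodType R) (e : 'I_4 -> V) a b k :
  [/\ \sum_j coefU a b k o0 j *: e j = a *: e o1,
      \sum_j coefU a b k o1 j *: e j = - a *: e o0 + b *: e o2 + k *: e o3,
      \sum_j coefU a b k o2 j *: e j = - b *: e o1 &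
      \sum_j coefU a b k o3 j *: e j = - k *: e o1].
Proof.
rewrite !sum4 /coefU /skew_unit /=.
by rewrite !(subr0, sub0r, subrr, mulr0, mulr1, mulrN1, addr0, add0r, scale0r).
Qed.

Lemma sum_coefV (V : lmodType R) (e : 'I_4 -> V) a b k :
  [/\ \sum_j coefV a b k o0 j *: e j = a *: e o2,
      \sum_j coefV a b k o1 j *: e j = b *: e o2,
      \sum_j coefV a b k o2 j *: e j = - a *: e o0 - b *: e o1 - k *: e o3 &
      \sum_j coefV a b k o3 j *: e j = k *: e o2].
Proof.
rewrite !sum4 /coefV /skew_unit /=.
rewrite !(subr0, sub0r, subrr, mulr0, mulr1, mulrN1, addr0, add0r, scale0r).
by rewrite !(oppr0, opprK, addr0, add0r, scale0r, scaleNr).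
Qed.

Lemma is_derive_line (V : normedModType R) (f : R * R -> V) p w df :
  is_derive p w f df <-> is_derive (0 : R) 1 (fun h => f (h *: w + p)) df.
Proof.
have E : (fun h : R => h^-1 *: ((f \o shift p) (h *: w) - f p)) =
    (fun h : R => h^-1 *: (((fun h => f (h *: w + p)) \o shift 0) (h *: 1)
                           - f (0 *: w + p))).
  by apply/funext => h; rewrite /= addr0 scale0r add0r [h *: 1]mulr1.
by split => -[dp dE]; split; move: dp dE; rewrite /derivable /derive E.
Qed.

Lemma is_derive_chain (g : R -> R) (f : R * R -> R) p w df dg :
  is_derive p w f df -> is_derive (f p) 1 g dg ->
  is_derive p w (fun q => g (f q)) (dg * df).
Proof.
move=> /is_derive_line fd gd; apply/is_derive_line.
by apply: is_derive1_comp fd; rewrite scale0r add0r.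
Qed.

End Coefficients.

Section Potential.
Context {R : realType}.
Variables (D : set (R * R)) (nu : R * R -> R).
Hypotheses (oD : open D) (nus : smooth_on D nu) (nu0 : forall p, D p -> 0 < nu p).

(** In the parameters at hand [isqrt_nu] is the common value of [sqrt E] and [sqrt G];
    [half_dlog_u] and [half_dlog_v] are half the derivatives of [ln nu]. *)
Definition sqrt_nu q := Num.sqrt (nu q).
Definition isqrt_nu q := (Num.sqrt (nu q))^-1.
Definition half_dlog_u q := isqrt_nu q * du sqrt_nu q.
Definition half_dlog_v q := isqrt_nu q * dv sqrt_nu q.
Local Notation k := sqrt_nu.
Local Notation a := isqrt_nu.

Lemma sqrt_nu_gt0 p : D p -> 0 < k p.
Proof. by move=> Dp; rewrite sqrtr_gt0 nu0. Qed.

Lemma isqrt_nu_gt0 p : D p -> 0 < a p.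
Proof. by move=> Dp; rewrite invr_gt0 sqrt_nu_gt0. Qed.

Lemma sqrt_nu_sqr p : D p -> k p ^+ 2 = nu p.
Proof. by move=> Dp; rewrite sqr_sqrtr// ltW// nu0. Qed.

Lemma isqrt_nuK p : D p -> a p * k p = 1.
Proof. by move=> Dp; rewrite mulVf// gt_eqF// sqrt_nu_gt0. Qed.

Lemma isqrt_nu_sqr p : D p -> a p ^+ 2 = (nu p)^-1.
Proof. by move=> Dp; rewrite -sqrt_nu_sqr// exprVn. Qed.

Lemma is_derive_sqrt_nu p w dnu : D p -> is_derive p w nu dnu ->
  is_derive p w k (2^-1 * dnu * a p).
Proof.
move=> Dp nud; apply: is_derive_eq (is_derive_chain nud (is_derive1_sqrt (nu0 Dp))) _.
by rewrite invfM -/(a p); ring.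
Qed.

Lemma is_derive_isqrt_nu p w dk : D p -> is_derive p w k dk ->
  is_derive p w a (- (a p * dk) * a p).
Proof.
move=> Dp kd; have k0 : k p != 0 by rewrite gt_eqF// sqrt_nu_gt0.
have id1 : is_derive (k p) 1 (fun x : R => x^-1) (- (k p) ^- 2 *: 1).
  exact: is_deriveV.
apply: is_derive_eq (is_derive_chain kd id1) _.
by rewrite [_ *: 1]mulr1 /isqrt_nu -/(k p); field.
Qed.

(** With [k = sqrt_nu] and [a = isqrt_nu], the derivatives [k_u = nu_u a / 2] and
    [a_u = - a ^ 2 k_u] are polynomials in [k], [a] and the derivatives of [nu]. *)
Lemma smooth_sqrt_nu : smooth_on D k /\ smooth_on D a.
Proof.
pose T g := g = k \/ g = a.
pose P := alg (fun g => T g \/ smooth_on D g).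
have TP g : T g -> P g by move=> Tg; apply: alg_gen; left.
have Pk : P k by apply: TP; left.
have Pa : P a by apply: TP; right.
have kd : has_partials D k (fun p => 2^-1 * du nu p * a p) (fun p => 2^-1 * dv nu p * a p).
  move=> p Dp; have [nuc nuu nuv] := smooth_has_partials nus Dp.
  split; [|exact: is_derive_sqrt_nu..].
  exact: continuous_comp nuc (@sqrt_continuous _ _).
have PM c f : P f -> P a -> P (fun p => c * f p * a p).
  move=> Pf _; apply: alg_mul => //.
  by apply: (alg_mul (f := cst c)) => //; apply: alg_cst.
have Pku : P (fun p => 2^-1 * du nu p * a p).
  by apply: PM => //; apply: alg_gen; right; apply: smooth_on_du.
have Pkv : P (fun p => 2^-1 * dv nu p * a p).
  by apply: PM => //; apply: alg_gen; right; apply: smooth_on_dv.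
have H g : T g -> exists gu gv, [/\ P gu, P gv & has_partials D g gu gv].
  case=> ->; first by eexists; eexists; split; [exact: Pku|exact: Pkv|].
  exists (fun p => (-1 * (a p * (2^-1 * du nu p * a p))) * a p),
         (fun p => (-1 * (a p * (2^-1 * dv nu p * a p))) * a p).
  split; [by apply: PM => //; apply: alg_mul..|].
  move=> p Dp; have [kc ku kv] := kd p Dp.
  split; [|by rewrite mulN1r; apply: is_derive_isqrt_nu..].
  by apply: continuousV kc; rewrite gt_eqF// sqrt_nu_gt0.
by split; apply: (smooth_extension (T := T)).
Qed.

Lemma smooth_half_dlog : smooth_on D half_dlog_u /\ smooth_on D half_dlog_v.
Proof.
have [ks a_smooth] := smooth_sqrt_nu.
split; first exact: (smooth_on_mul oD a_smooth (smooth_on_du ks)).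
exact: (smooth_on_mul oD a_smooth (smooth_on_dv ks)).
Qed.

Lemma derive_sqrt_nuE p : D p ->
  du k p = half_dlog_u p * k p /\ dv k p = half_dlog_v p * k p.
Proof.
move=> Dp; have e x : x = a p * x * k p by rewrite mulrAC isqrt_nuK// mul1r.
by split; apply: e.
Qed.

Lemma derive_isqrt_nuE p : D p ->
  du a p = - half_dlog_u p * a p /\ dv a p = - half_dlog_v p * a p.
Proof.
move=> Dp; have [_ ku kv] := smooth_has_partials smooth_sqrt_nu.1 Dp.
split.
  exact: (is_deriveE (is_derive_isqrt_nu Dp ku)).
exact: (is_deriveE (is_derive_isqrt_nu Dp kv)).
Qed.

Lemma derive_nuE p w dk : D p -> is_derive p w k dk -> is_derive p w nu (2 * k p * dk).
Proof.
move=> Dp kd; apply: (is_derive_on (f := fun q => k q * k q) oD Dp).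
  by move=> q Dq; rewrite -expr2 sqrt_nu_sqr.
apply: is_derive_eq (is_deriveM kd kd) _; rewrite /GRing.scale /=; ring.
Qed.

Lemma is_derive_ln_nu p w dk : D p -> is_derive p w k dk ->
  is_derive p w (fun q => ln (nu q)) (2 * (a p * dk)).
Proof.
move=> Dp kd; have nud := derive_nuE Dp kd.
apply: is_derive_eq (is_derive_chain nud (is_derive1_ln (nu0 Dp))) _.
rewrite -isqrt_nu_sqr// -[RHS]mul1r -(isqrt_nuK Dp); ring.
Qed.

(** The left-hand side is half the Laplacian of [ln nu]. *)
Lemma gauss_equation p : D p ->
  laplacian (fun q => ln (nu q)) p = 2 * ((1 - nu p ^+ 2) / nu p) ->
  du half_dlog_u p + dv half_dlog_v p = a p ^+ 2 - k p ^+ 2.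
Proof.
move=> Dp; rewrite /laplacian.
have [lus lvs] := smooth_half_dlog.
have [_ du_lu _] := smooth_has_partials lus Dp.
have [_ _ dv_lv] := smooth_has_partials lvs Dp.
have -> : du (du (fun q => ln (nu q))) p = 2 * du half_dlog_u p.
  have E q : D q -> du (fun q => ln (nu q)) q = 2 * half_dlog_u q.
    move=> Dq; have [_ ku _] := smooth_has_partials smooth_sqrt_nu.1 Dq.
    exact: (is_deriveE (is_derive_ln_nu Dq ku)).
  rewrite {1}/du (derive_on _ oD Dp E).
  exact: (is_deriveE (is_deriveZ 2 du_lu)).
have -> : dv (dv (fun q => ln (nu q))) p = 2 * dv half_dlog_v p.
  have E q : D q -> dv (fun q => ln (nu q)) q = 2 * half_dlog_v q.
    move=> Dq; have [_ _ kv] := smooth_has_partials smooth_sqrt_nu.1 Dq.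
    exact: (is_deriveE (is_derive_ln_nu Dq kv)).
  rewrite {1}/dv (derive_on _ oD Dp E).
  exact: (is_deriveE (is_deriveZ 2 dv_lv)).
rewrite -mulrDr => /(mulfI (_ : 2 != 0 :> R)) -> ; last by rewrite pnatr_eq0.
have n0 : nu p != 0 by rewrite gt_eqF// nu0.
by rewrite isqrt_nu_sqr// sqrt_nu_sqr//; field.
Qed.

End Potential.

(** * Surfaces and integral frames *)

Section SurfaceFrame.
Context {R : realType}.
Variables (D S : set (R * R)) (nu : R * R -> R).
Hypotheses (oD : open D) (nus : smooth_on D nu) (nu0 : forall p, D p -> 0 < nu p).
Hypotheses (oS : open S) (SD : S `<=` D).
Implicit Types (p q : R * R) (l N : R * R -> 'rV[R]_4).
Local Notation k := (sqrt_nu nu).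
Local Notation a := (isqrt_nu nu).

Definition frameU i j p := coefU (a p) (half_dlog_v nu p) (k p) i j.
Definition frameV i j p := coefV (a p) (- half_dlog_u nu p) (k p) i j.

Lemma smooth_frame_coef (f g h : R * R -> R) (c d b : R) :
  smooth_on D f -> smooth_on D g -> smooth_on D h ->
  smooth_on D (fun q => f q * c + g q * d + h q * b).
Proof.
move=> fs gs hs; apply: alg_smooth oD _.
have scale (f' : R * R -> R) (x : R) :
    smooth_on D f' -> alg (smooth_on D) (fun q => f' q * x).
  by move=> fs'; apply: (alg_mul (g := cst x)); [apply: alg_gen | apply: alg_cst].
by apply: alg_add (scale _ _ hs); apply: alg_add (scale _ _ fs) (scale _ _ gs).
Qed.

Lemma is_derive_frame_coef (f g h : R * R -> R) (c d b : R) p w df dg dh :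
  is_derive p w f df -> is_derive p w g dg -> is_derive p w h dh ->
  is_derive p w (fun q => f q * c + g q * d + h q * b) (df * c + dg * d + dh * b).
Proof.
have smul (f' : R * R -> R) df' (x : R) :
    is_derive p w f' df' -> is_derive p w (fun q => f' q * x) (df' * x).
  move=> fd; apply: is_derive_eq (is_deriveM fd (is_derive_cst x p w)) _.
  by rewrite scaler0 add0r [LHS]mulrC.
move=> fd gd hd.
exact: is_deriveD (is_deriveD (smul _ _ c fd) (smul _ _ d gd)) (smul _ _ b hd).
Qed.

Lemma frameVE i j : frameV i j = fun q => a q * skew_unit o0 o2 i j
  + half_dlog_u nu q * - skew_unit o1 o2 i j + k q * - skew_unit o2 o3 i j.
Proof. by apply/funext => q; rewrite /frameV /coefV; ring. Qed.

Lemma smooth_frameU i j : smooth_on D (frameU i j).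
Proof.
have [ks a_smooth] := smooth_sqrt_nu oD nus nu0; have [_ lvs] := smooth_half_dlog oD nus nu0.
exact: smooth_frame_coef a_smooth lvs ks.
Qed.

Lemma smooth_frameV i j : smooth_on D (frameV i j).
Proof.
have [ks a_smooth] := smooth_sqrt_nu oD nus nu0; have [lus _] := smooth_half_dlog oD nus nu0.
rewrite frameVE; exact: smooth_frame_coef a_smooth lus ks.
Qed.

Lemma frame_compat :
  (forall p, D p -> laplacian (fun q => ln (nu q)) p = 2 * ((1 - nu p ^+ 2) / nu p)) ->
  forall i j p, D p ->
    dv (frameU i j) p + \sum_m frameU i m p * frameV m j p =
    du (frameV i j) p + \sum_m frameV i m p * frameU m j p.
Proof.
move=> pde i j p Dp.
have [ks a_smooth] := smooth_sqrt_nu oD nus nu0; have [lus lvs] := smooth_half_dlog oD nus nu0.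
have [_ ku kv] := smooth_has_partials ks Dp.
have [_ au av] := smooth_has_partials a_smooth Dp.
have [_ lu _] := smooth_has_partials lus Dp.
have [_ _ lv] := smooth_has_partials lvs Dp.
have [kuE kvE] := derive_sqrt_nuE nu0 Dp.
have [auE avE] := derive_isqrt_nuE oD nus nu0 Dp.
have dU := is_derive_frame_coef (skew_unit o0 o1 i j) (skew_unit o1 o2 i j)
  (skew_unit o1 o3 i j) av lv kv.
have dV := is_derive_frame_coef (skew_unit o0 o2 i j) (- skew_unit o1 o2 i j)
  (- skew_unit o2 o3 i j) au lu ku.
have eU : dv (frameU i j) p = dv a p * skew_unit o0 o1 i j
    + dv (half_dlog_v nu) p * skew_unit o1 o2 i j + dv k p * skew_unit o1 o3 i j.
  exact: is_deriveE dU.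
have eV : du (frameV i j) p = du a p * skew_unit o0 o2 i j
    + du (half_dlog_u nu) p * - skew_unit o1 o2 i j + du k p * - skew_unit o2 o3 i j.
  by rewrite frameVE; exact: is_deriveE dV.
have -> : dv (frameU i j) p =
    coefU (- half_dlog_v nu p * a p) (dv (half_dlog_v nu) p) (half_dlog_v nu p * k p) i j.
  by rewrite eU avE kvE.
have -> : du (frameV i j) p =
    coefV (- half_dlog_u nu p * a p) (- du (half_dlog_u nu) p) (half_dlog_u nu p * k p) i j.
  by rewrite eV auE kuE /coefV; ring.
apply: (@coef_compat R (a p) (k p) (half_dlog_u nu p) (half_dlog_v nu p)).
  exact: (isqrt_nuK nu0 Dp).
exact: (gauss_equation oD nus nu0 Dp (pde p Dp)).
Qed.

(** Rows [0] and [3] are the position and the normal of the surface, rows [1] and [2]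
    the unit vectors along the parametric lines. *)
Definition integral_frame (e : 'I_4 -> R * R -> 'rV[R]_4) :=
  [/\ forall i, smooth_on S (e i), forall p, S p -> orthonormal_frame (e ^~ p) &
    forall i p, S p ->
      is_derive p (1, 0) (e i) (\sum_j frameU i j p *: e j p) /\
      is_derive p (0, 1) (e i) (\sum_j frameV i j p *: e j p)].

Lemma sqrt_nu_partials p : S p ->
  [/\ is_derive p (1, 0) k (half_dlog_u nu p * k p), is_derive p (0, 1) k (half_dlog_v nu p * k p),
      is_derive p (1, 0) a (- half_dlog_u nu p * a p) &
      is_derive p (0, 1) a (- half_dlog_v nu p * a p)].
Proof.
move=> /SD Dp; have [ks a_smooth] := smooth_sqrt_nu oD nus nu0.
have [_ ku kv] := smooth_has_partials ks Dp.
have [_ au av] := smooth_has_partials a_smooth Dp.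
have [kuE kvE] := derive_sqrt_nuE nu0 Dp.
have [auE avE] := derive_isqrt_nuE oD nus nu0 Dp.
split; [exact: is_derive_eq ku kuE|exact: is_derive_eq kv kvE
  |exact: is_derive_eq au auE|exact: is_derive_eq av avE].
Qed.

Section FromFrame.
Variable e : 'I_4 -> R * R -> 'rV[R]_4.
Hypothesis eP : integral_frame e.
Hypothesis nu_uv : forall p, D p -> du nu p * dv nu p != 0.
Let l := e o0.
Let N := e o3.

Let orth p i j : S p -> dotv (e i p) (e j p) = (i == j)%:R.
Proof. by case: eP => _ h _ /h. Qed.

Lemma frame_du_l p : S p -> du l p = a p *: e o1 p.
Proof.
case: eP => _ _ ed Sp; have [/is_deriveE E _] := ed o0 p Sp.
rewrite /du E; by have [-> _ _ _] := sum_coefU (e ^~ p) (a p) (half_dlog_v nu p) (k p).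
Qed.

Lemma frame_dv_l p : S p -> dv l p = a p *: e o2 p.
Proof.
case: eP => _ _ ed Sp; have [_ /is_deriveE E] := ed o0 p Sp.
rewrite /dv E; by have [-> _ _ _] := sum_coefV (e ^~ p) (a p) (- half_dlog_u nu p) (k p).
Qed.

Lemma frame_second_derivatives p : S p ->
  [/\ du (du l) p = (- half_dlog_u nu p * a p) *: e o1 p +
        a p *: (- a p *: e o0 p + half_dlog_v nu p *: e o2 p + k p *: e o3 p),
      dv (du l) p = (- half_dlog_v nu p * a p) *: e o1 p + a p *: (- half_dlog_u nu p *: e o2 p) &
      dv (dv l) p = (- half_dlog_v nu p * a p) *: e o2 p +
        a p *: (- a p *: e o0 p - - half_dlog_u nu p *: e o1 p - k p *: e o3 p)].
Proof.
move=> Sp; case: eP => _ _ ed; have [_ _ au av] := sqrt_nu_partials Sp.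
have [_ U1 _ _] := sum_coefU (e ^~ p) (a p) (half_dlog_v nu p) (k p).
have [_ V1 V2 _] := sum_coefV (e ^~ p) (a p) (- half_dlog_u nu p) (k p).
have [e1u e1v] := ed o1 p Sp; have [_ e2v] := ed o2 p Sp.
rewrite /frameU U1 in e1u; rewrite /frameV V1 in e1v; rewrite /frameV V2 in e2v.
split.
- rewrite {1}/du (derive_on _ oS Sp frame_du_l); exact: is_deriveE (is_derive_scale au e1u).
- rewrite {1}/dv (derive_on _ oS Sp frame_du_l); exact: is_deriveE (is_derive_scale av e1v).
- rewrite {1}/dv (derive_on _ oS Sp frame_dv_l); exact: is_deriveE (is_derive_scale av e2v).
Qed.

Lemma frame_forms p : S p ->
  [/\ formE l p = (nu p)^-1, formF l p = 0 & formG l p = (nu p)^-1] /\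
  [/\ forme l N p = 1, formf l N p = 0 & formg l N p = -1].
Proof.
move=> Sp; have Dp := SD Sp; have [Euu Euv Evv] := frame_second_derivatives Sp.
rewrite /formE /formF /formG /forme /formf /formg Euu Euv Evv.
rewrite frame_du_l// frame_dv_l//.
rewrite !(dotvDl, dotvNl, dotvZl, dotvZr, orth) //=.
have ak := isqrt_nuK nu0 Dp; rewrite -(isqrt_nu_sqr nu0 Dp).
move: (half_dlog_u nu p) (half_dlog_v nu p) (a p) (k p) ak => bu bv x y xy.
by split; split; lra.
Qed.

Lemma frame_invariants p : S p ->
  [/\ nu1 l N p = nu p, nu2 l N p = - nu p,
      gamma1 l p = dv k p & gamma2 l p = - du k p].
Proof.
move=> Sp; have Dp := SD Sp; have [[E F G] [ee f g]] := frame_forms Sp.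
have n0 : nu p != 0 by rewrite gt_eqF// nu0.
have k0 := sqrt_nu_gt0 nu0 Dp; have a0 := isqrt_nu_gt0 nu0 Dp.
have k20 := sqrt_nu_sqr nu0 Dp.
have sqrtE : Num.sqrt (nu p)^-1 = a p by rewrite sqrtrV// ltW// nu0.
have [ku kv au av] := sqrt_nu_partials Sp.
have [duk dvk] := derive_sqrt_nuE nu0 Dp.
have EE q : S q -> formE l q = a q * a q.
  by move=> Sq; have [[-> _ _] _] := frame_forms Sq; rewrite -expr2 (isqrt_nu_sqr nu0 (SD Sq)).
have GG q : S q -> formG l q = a q * a q.
  by move=> Sq; have [[_ _ ->] _] := frame_forms Sq; rewrite -expr2 (isqrt_nu_sqr nu0 (SD Sq)).
have dE : dv (formE l) p = - 2 * half_dlog_v nu p * (nu p)^-1.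
  rewrite {1}/dv (derive_on _ oS Sp EE) (is_deriveE (is_deriveM av av)).
  by rewrite /GRing.scale /= -(isqrt_nu_sqr nu0 Dp); ring.
have dG : du (formG l) p = - 2 * half_dlog_u nu p * (nu p)^-1.
  rewrite {1}/du (derive_on _ oS Sp GG) (is_deriveE (is_deriveM au au)).
  by rewrite /GRing.scale /= -(isqrt_nu_sqr nu0 Dp); ring.
have inv_a : (a p)^-1 = k p by rewrite /isqrt_nu invrK.
split.
- by rewrite /nu1 ee E invrK mul1r.
- by rewrite /nu2 g G invrK mulN1r.
- rewrite /gamma1 dE E G sqrtE dvk invfM inv_a; field.
  by rewrite n0.
- rewrite /gamma2 dG E G sqrtE duk invfM inv_a; field.
  by rewrite n0.
Qed.

Lemma solution_of_integral_frame p0 : S p0 ->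
  solution_surface S l N nu p0 (e o0 p0) (e o1 p0) (e o2 p0) (e o3 p0).
Proof.
move=> Sp0; have [es _ _] := eP.
have gt0 p : S p -> 0 < nu p by move=> /SD; apply: nu0.
have sqrtE p : S p -> Num.sqrt (nu p)^-1 = a p by move=> Sp; rewrite sqrtrV// ltW// gt0.
have aV p : S p -> (a p)^-1 * a p = 1.
  by move=> Sp; rewrite mulVf// gt_eqF//; apply: (isqrt_nu_gt0 nu0 (SD Sp)).
have tangent p x : S p -> (Num.sqrt (nu p)^-1)^-1 *: (a p *: x) = x :> 'rV[R]_4.
  by move=> Sp; rewrite sqrtE// scalerA aV// scale1r.
have inv p (Sp : S p) := frame_invariants Sp.
have forms p (Sp : S p) := frame_forms Sp.
have principal : principal_parameters S l N.
  split=> p Sp; have [[E F G] [ee f g]] := forms p Sp; last by [].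
  move=> [c [ce _ cg]]; move: ce cg; rewrite ee g E G => <-; lra.
split; split.
- split.
  + exact: es.
  + exact: es.
  + by move=> p Sp; rewrite orth.
  + move=> p Sp; rewrite frame_du_l// frame_dv_l//.
    have an0 : a p != 0 by rewrite gt_eqF// (isqrt_nu_gt0 nu0 (SD Sp)).
    have dot11 : dotv (a p *: e o1 p) (e o1 p) = a p by rewrite dotvZl orth//= mulr1.
    have dot22 : dotv (a p *: e o2 p) (e o2 p) = a p by rewrite dotvZl orth//= mulr1.
    rewrite free_cons seq1_free span_seq1; apply/andP; split.
      apply/negP => /vlineP[c cE]; move: an0; rewrite -dot11 cE !dotvZl orth//=.
      by rewrite !mulr0 eqxx.
    apply/eqP => e20; move: an0; rewrite -dot22 e20 -(scale0r (e o0 p)) dotvZl.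
    by rewrite mul0r eqxx.
  + by move=> p Sp; rewrite frame_du_l// frame_dv_l// !dotvZr !orth//= !mulr0.
- by move=> p Sp; have [-> -> _ _] := inv p Sp; rewrite subrr.
- split=> // p Sp; have [-> -> -> ->] := inv p Sp.
  have [_ ku kv] := smooth_has_partials (smooth_sqrt_nu oD nus nu0).1 (SD Sp).
  have duE : du nu p = _ := is_deriveE (derive_nuE oD nu0 (SD Sp) ku).
  have dvE : dv nu p = _ := is_deriveE (derive_nuE oD nu0 (SD Sp) kv).
  have := nu_uv (SD Sp); rewrite duE dvE.
  move: (du k p) (dv k p) (gt0 p Sp) => c d nu_p.
  rewrite !mulf_eq0 !negb_or oppr_eq0 => /andP[/andP[_ ->] /andP[_ ->]].
  rewrite opprK -mulr2n mulrn_eq0 /= (gt_eqF nu_p).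
  by [].
- split=> // p Sp; have [-> _ _ _] := inv p Sp.
  by have [[-> _ ->] _] := forms p Sp.
- have [[E F G] _] := forms p0 Sp0.
  split=> //; first by rewrite /tangentX E frame_du_l// tangent.
  by rewrite /tangentY G frame_dv_l// tangent.
- exact: inv.
Qed.

End FromFrame.

Lemma frame_entriesU (c a k b : R) (z x y xx xy n dn : 'rV[R]_4) :
  a * k = 1 -> dotv x x = a ^+ 2 -> dotv x y = 0 -> dotv n x = 0 -> dotv n y = 0 ->
  dotv xx y + dotv x xy = 0 -> 2 * dotv x xy = - 2 * b * a ^+ 2 ->
  dotv xx n = 1 -> dotv xy n = 0 ->
  forall i j : 'I_4, (i < j)%N ->
    dotv (nth 0 [:: x; (c * k) *: x + k *: xx; (c * k) *: y + k *: xy; dn] i)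
         (nth 0 [:: z; k *: x; k *: y; n] j) = coefU a b k i j.
Proof.
move=> ak xx2 xy0 nx ny xxy xxy' xxn xyn; rewrite dotvC in nx; rewrite dotvC in ny.
have ka2 : k * a ^+ 2 = a by rewrite -[RHS]mulr1 -ak; ring.
have xxy2 : dotv xx y = b * a ^+ 2 by lra.
have kkb : k * (k * (b * a ^+ 2)) = b by rewrite -[RHS]mulr1 -[RHS]mulr1 -ak; ring.
rewrite /coefU /skew_unit; apply: ord4_lt_ind;
  rewrite /= ?(dotvDl, dotvZl, dotvZr) ?xx2 ?xy0 ?nx ?ny ?xxy2 ?xxn ?xyn; lra.
Qed.

Lemma frame_entriesV (d a k c : R) (z x y xy yy n dn : 'rV[R]_4) :
  a * k = 1 -> dotv y y = a ^+ 2 -> dotv x y = 0 -> dotv n x = 0 -> dotv n y = 0 ->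
  2 * dotv xy y = - 2 * c * a ^+ 2 -> dotv yy n = -1 -> dotv xy n = 0 ->
  forall i j : 'I_4, (i < j)%N ->
    dotv (nth 0 [:: y; (d * k) *: x + k *: xy; (d * k) *: y + k *: yy; dn] i)
         (nth 0 [:: z; k *: x; k *: y; n] j) = coefV a (- c) k i j.
Proof.
move=> ak yy2 xy0 nx ny xyy yyn xyn; rewrite dotvC in nx; rewrite dotvC in ny.
have ka2 : k * a ^+ 2 = a by rewrite -[RHS]mulr1 -ak; ring.
have xyy2 : dotv xy y = - c * a ^+ 2 by lra.
have kkc : k * (k * (- c * a ^+ 2)) = - c by rewrite -[RHS]mulr1 -[RHS]mulr1 -ak; ring.
have yx0 : dotv y x = 0 by rewrite dotvC.
rewrite /coefV /skew_unit; apply: ord4_lt_ind;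
  rewrite /= ?(dotvDl, dotvZl, dotvZr) ?yy2 ?xy0 ?yx0 ?nx ?ny ?xyy2 ?yyn ?xyn; lra.
Qed.

(** Since [E = G = 1 / nu], multiplication by [k] normalizes the coordinate fields.  By
    skew-symmetry only the entries of the derivational matrices above the diagonal
    matter.  Those in the first row and the last column are given by the definitions
    of the frame and of the second fundamental form; [X_u . Y] and [X_v . Y] are
    obtained by differentiating [F = 0], [E] and [G] and using [l_uv = l_vu]. *)
Lemma integral_frame_of_solution l N p0 x y z n :
  solution_surface S l N nu p0 x y z n ->
  integral_frame (fun i q => nth 0 [:: l q; k q *: du l q; k q *: dv l q; N q] i).
Proof.
move=> [[[ls Ns l1 _ Nl] _ _] [[[_ FfP] canonical] _ inv]].
set e := fun i q => _.
have EG p : S p -> formE l p = a p ^+ 2 /\ formG l p = a p ^+ 2.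
  move=> Sp; have [nuE _ _ _] := inv p Sp; have [-> ->] := canonical p Sp.
  by rewrite nuE (isqrt_nu_sqr nu0 (SD Sp)).
have smooth_scale (L : R * R -> 'rV[R]_4) : smooth_on S L ->
    smooth_on S (fun q => k q *: L q).
  move=> Ls; apply/(smooth_rowP _ oS) => i.
  have -> : (fun q => (k q *: L q) 0 i) = (fun q => k q * L q 0 i).
    by apply/funext => q; rewrite mxE.
  apply: smooth_on_mul oS _ _; last by move/(smooth_rowP _ oS): Ls; apply.
  exact: smooth_on_subset SD (smooth_sqrt_nu oD nus nu0).1.
have es i : smooth_on S (e i).
  move: i; apply: ord4_ind => /=.
  - exact: ls.
  - exact: smooth_scale (smooth_on_du ls).
  - exact: smooth_scale (smooth_on_dv ls).
  - exact: Ns.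
have lu p : S p -> is_derive p (1, 0) l (du l p) by move=> /(smooth_has_partials ls)[].
have lv p : S p -> is_derive p (0, 1) l (dv l p) by move=> /(smooth_has_partials ls)[].
have l_tangent p : S p -> dotv (l p) (du l p) = 0 /\ dotv (l p) (dv l p) = 0.
  move=> Sp; have ll q : S q -> dotv (l q) (l q) = cst (1 : R) q by move=> /l1.
  have l0 w dl : is_derive p w l dl -> dotv (l p) dl = 0.
    move=> ld; have := is_deriveE (is_derive_dotv ld ld).
    rewrite (derive_on w oS Sp ll) (is_deriveE (is_derive_cst _ _ _)) (dotvC dl); lra.
  by split; apply: l0; [apply: lu | apply: lv].
have eo p : S p -> orthonormal_frame (e ^~ p).
  move=> Sp; have [E G] := EG p Sp; have [F _] := FfP p Sp.
  have [NN Nl0 Nu Nv] := Nl p Sp; have [lu0 lv0] := l_tangent p Sp.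
  have ak := isqrt_nuK nu0 (SD Sp).
  have sym i j : dotv (e i p) (e j p) = (i == j)%:R -> dotv (e j p) (e i p) = (j == i)%:R.
    by rewrite dotvC eq_sym.
  have kak : k p * (k p * a p ^+ 2) = 1.
    by rewrite -[RHS]mulr1 -ak; ring.
  have e00 : dotv (e o0 p) (e o0 p) = 1 by apply: l1.
  have e01 : dotv (e o0 p) (e o1 p) = 0 by rewrite /e /= dotvZr lu0 mulr0.
  have e02 : dotv (e o0 p) (e o2 p) = 0 by rewrite /e /= dotvZr lv0 mulr0.
  have e03 : dotv (e o0 p) (e o3 p) = 0 by rewrite dotvC.
  have e11 : dotv (e o1 p) (e o1 p) = 1 by rewrite /e /= dotvZr dotvZl -/(formE l p) E.
  have e12 : dotv (e o1 p) (e o2 p) = 0.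
    by rewrite /e /= dotvZr dotvZl -/(formF l p) F !mulr0.
  have e13 : dotv (e o1 p) (e o3 p) = 0 by rewrite dotvC /e /= dotvZr Nu mulr0.
  have e22 : dotv (e o2 p) (e o2 p) = 1 by rewrite /e /= dotvZr dotvZl -/(formG l p) G.
  have e23 : dotv (e o2 p) (e o3 p) = 0 by rewrite dotvC /e /= dotvZr Nv mulr0.
  have e33 : dotv (e o3 p) (e o3 p) = 1 by [].
  apply: ord4_ind; apply: ord4_ind;
    [exact: e00|exact: e01|exact: e02|exact: e03
    |exact: (sym _ _ e01)|exact: e11|exact: e12|exact: e13
    |exact: (sym _ _ e02)|exact: (sym _ _ e12)|exact: e22|exact: e23
    |exact: (sym _ _ e03)|exact: (sym _ _ e13)|exact: (sym _ _ e23)|exact: e33].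
split; [exact: es|exact: eo|move=> i p Sp].
have [E G] := EG p Sp; have [F f0] := FfP p Sp.
have [NN Nl0 Nu Nv] := Nl p Sp.
have ak := isqrt_nuK nu0 (SD Sp).
have [ku kv au av] := sqrt_nu_partials Sp.
have [_ luu luv] := smooth_has_partials (smooth_on_du ls) Sp.
have [_ lvu lvv] := smooth_has_partials (smooth_on_dv ls) Sp.
have [_ Nu' Nv'] := smooth_has_partials Ns Sp.
rewrite (mixed_partials_eq oS Sp ls) in lvu.
have Fu : dotv (du (du l) p) (dv l p) + dotv (du l p) (dv (du l) p) = 0.
  have F0 q : S q -> dotv (du l q) (dv l q) = cst (0 : R) q by move=> /FfP[].
  rewrite -(is_deriveE (is_derive_dotv luu lvu)) (derive_on _ oS Sp F0).
  exact: is_deriveE (is_derive_cst _ _ _).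
have Ev : 2 * dotv (du l p) (dv (du l) p) = - 2 * half_dlog_v nu p * a p ^+ 2.
  have E0 q : S q -> dotv (du l q) (du l q) = a q * a q.
    by move=> Sq; rewrite -expr2; exact: (EG q Sq).1.
  transitivity (dotv (dv (du l) p) (du l p) + dotv (du l p) (dv (du l) p)).
    by rewrite (dotvC (dv (du l) p)) mulr_natl mulr2n.
  rewrite -(is_deriveE (is_derive_dotv luv luv)) (derive_on _ oS Sp E0).
  by rewrite (is_deriveE (is_deriveM av av)) /GRing.scale /=; ring.
have Gu : 2 * dotv (dv (du l) p) (dv l p) = - 2 * half_dlog_u nu p * a p ^+ 2.
  have G0 q : S q -> dotv (dv l q) (dv l q) = a q * a q.
    by move=> Sq; rewrite -expr2; exact: (EG q Sq).2.
  transitivity (dotv (dv (du l) p) (dv l p) + dotv (dv l p) (dv (du l) p)).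
    by rewrite (dotvC (dv l p)) mulr_natl mulr2n.
  rewrite -(is_deriveE (is_derive_dotv lvu lvu)) (derive_on _ oS Sp G0).
  by rewrite (is_deriveE (is_deriveM au au)) /GRing.scale /=; ring.
have [en gn] : dotv (du (du l) p) (N p) = 1 /\ dotv (dv (dv l) p) (N p) = -1.
  have [n1 n2 _ _] := inv p Sp; have a20 : a p ^+ 2 != 0.
    by rewrite expf_neq0// gt_eqF// (isqrt_nu_gt0 nu0 (SD Sp)).
  have nu_a : nu p * a p ^+ 2 = 1.
    by rewrite (isqrt_nu_sqr nu0 (SD Sp)) mulfV ?(gt_eqF (nu0 (SD Sp))).
  have n1' : dotv (du (du l) p) (N p) / formE l p = nu p := n1.
  have n2' : dotv (dv (dv l) p) (N p) / formG l p = - nu p := n2.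
  split; first by rewrite -[LHS](divfK a20) -{1}E n1' nu_a.
  by rewrite -[LHS](divfK a20) -{1}G n2' mulNr nu_a.
pose Wu (i : 'I_4) := nth 0 [:: du l p; (half_dlog_u nu p * k p) *: du l p + k p *: du (du l) p;
  (half_dlog_u nu p * k p) *: dv l p + k p *: dv (du l) p; du N p] i.
pose Wv (i : 'I_4) := nth 0 [:: dv l p; (half_dlog_v nu p * k p) *: du l p + k p *: dv (du l) p;
  (half_dlog_v nu p * k p) *: dv l p + k p *: dv (dv l) p; dv N p] i.
have Wud j : is_derive p (1, 0) (e j) (Wu j).
  move: j; apply: ord4_ind; [exact: lu|exact: is_derive_scale ku luu
    |exact: is_derive_scale ku lvu|exact: Nu'].
have Wvd j : is_derive p (0, 1) (e j) (Wv j).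
  move: j; apply: ord4_ind; [exact: lv|exact: is_derive_scale kv luv
    |exact: is_derive_scale kv lvv|exact: Nv'].
have E' : dotv (du l p) (du l p) = a p ^+ 2 := E.
have G' : dotv (dv l p) (dv l p) = a p ^+ 2 := G.
have F' : dotv (du l p) (dv l p) = 0 := F.
have f' : dotv (dv (du l) p) (N p) = 0 := f0.
have upperU : forall i j : 'I_4, (i < j)%N -> dotv (Wu i) (e j p) = frameU i j p.
  exact: frame_entriesU ak E' F' Nu Nv Fu Ev en f'.
have upperV : forall i j : 'I_4, (i < j)%N -> dotv (Wv i) (e j p) = frameV i j p.
  exact: frame_entriesV ak G' F' Nu Nv Gu gn f'.
split.
  rewrite -(frame_equation oS Sp eo Wud _ upperU); first exact: Wud.
  by move=> j m; apply: coefU_skew.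
rewrite -(frame_equation oS Sp eo Wvd _ upperV); first exact: Wvd.
by move=> j m; apply: coefV_skew.
Qed.

Lemma frame_of_solution_init l N p0 x y z n : S p0 ->
  solution_surface S l N nu p0 x y z n ->
  forall i : 'I_4, nth 0 [:: l p0; k p0 *: du l p0; k p0 *: dv l p0; N p0] i =
    nth 0 [:: x; y; z; n] i.
Proof.
move=> Sp0 [_ [[_ canonical] [<- <- <- <-] inv]].
have [nuE _ _ _] := inv _ Sp0; have [E G] := canonical _ Sp0.
have sqrtE : (Num.sqrt (nu p0)^-1)^-1 = k p0.
  by rewrite sqrtrV ?invrK// ltW// nu0//; apply: SD.
by apply: ord4_ind; rewrite //= ?/tangentX ?/tangentY ?E ?G nuE sqrtE.
Qed.

End SurfaceFrame.

(** * The theorem *)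

Theorem theorem2p3 (R : realType) (D : set (R * R)) (u0 v0 : R)
    (nu : R * R -> R) (l0 X0 Y0 N0 : 'rV[R]_4)
    (D_open : open D) (D_p0 : D (u0, v0))
    (nu_smooth : smooth_on D nu)
    (nu_gt0 : forall p, D p -> 0 < nu p)
    (nu_uv_neq0 : forall p, D p -> du nu p * dv nu p != 0)
    (nu_pde : forall p, D p ->
       laplacian (fun q => ln (nu q)) p = 2 * ((1 - nu p ^+ 2) / nu p))
    (frame0 : right_oriented_orthonormal l0 X0 Y0 N0) :
  exists D0 : set (R * R),
    [/\ open D0, connected D0, D0 (u0, v0) & D0 `<=` D] /\
    exists l N : R * R -> 'rV[R]_4,
      solution_surface D0 l N nu (u0, v0) l0 X0 Y0 N0 /\
      forall l' N' : R * R -> 'rV[R]_4,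
        solution_surface D0 l' N' nu (u0, v0) l0 X0 Y0 N0 ->
        forall p, D0 p -> l' p = l p /\ N' p = N p.
Proof.
have Us := smooth_frameU D_open nu_smooth nu_gt0.
have Vs := smooth_frameV D_open nu_smooth nu_gt0.
have compat := frame_compat D_open nu_smooth nu_gt0 nu_pde.
have [r [r0 SD exY uniq]] := smooth_frobenius D_open D_p0 Us Vs compat.
set p0 := (u0, v0) in D_p0 SD exY uniq *; set S := square p0 r in SD exY uniq.
have oS : open S by apply: square_open.
have Sp0 : S p0 by apply: square_center.
exists S; split; first by split=> //; apply: square_connected.
pose f0 (i : 'I_4) : 'rV[R]_4 := nth 0 [:: l0; X0; Y0; N0] i.
have f0_orth : (\matrix_i f0 i) *m (\matrix_i f0 i)^T = 1%:M by case: frame0.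
(* [Y j] is the [j]-th column of the moving frame. *)
have /choice[Y YP] j := exY (fun i => f0 i 0 j).
pose e i q : 'rV[R]_4 := \row_j Y j i q.
have e_p0 i : e i p0 = f0 i by apply/rowP => j; rewrite mxE; case: (YP j).
have eP : integral_frame S nu e.
  split.
  - move=> i; apply/(smooth_rowP _ oS) => j.
    have -> : (fun q => e i q 0 j) = Y j i by apply/funext => q; rewrite mxE.
    by case: (YP j).
  - move=> p Sp; apply/orthonormal_mxP; apply: mulmx1C; apply/matrixP => j m.
    have [h0 _ hs] := YP j; have [h0' _ hs'] := YP m.
    have skU i n q : frameU nu i n q = - frameU nu n i q by apply: coefU_skew.
    have skV i n q : frameV nu i n q = - frameV nu n i q by apply: coefV_skew.
    have /matrixP /(_ j m) := mulmx1C f0_orth; rewrite !mxE => <-.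
    transitivity (\sum_i Y j i p * Y m i p).
      by apply: eq_bigr => i _; rewrite !mxE.
    rewrite (skew_solutions_dot skU skV hs hs' Sp).
    by apply: eq_bigr => i _; rewrite !mxE h0 h0'.
  - have entry i j : (fun q => e i q 0 j) = Y j i by apply/funext => q; rewrite mxE.
    move=> i p Sp; split; apply/is_derive_mxP => j; rewrite (entry i j).
      have [_ _ /(_ i p Sp)[h _]] := YP j; apply: is_derive_eq h _.
      by rewrite summxE; apply: eq_bigr => m _; rewrite !mxE.
    have [_ _ /(_ i p Sp)[_ h]] := YP j; apply: is_derive_eq h _.
    by rewrite summxE; apply: eq_bigr => m _; rewrite !mxE.
have := solution_of_integral_frame D_open nu_smooth nu_gt0 oS SD eP nu_uv_neq0 Sp0.
rewrite !e_p0 => sol; exists (e o0), (e o3); split; first exact: sol.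
move=> l' N' sol' p Sp.
have eP' := integral_frame_of_solution D_open nu_smooth nu_gt0 oS SD sol'.
set e' := fun i q => _ in eP'.
have e'_p0 i : e' i p0 = f0 i by apply: (frame_of_solution_init nu_gt0 SD Sp0 sol').
suff ee i : e' i p = e i p by split; [exact: (ee o0) | exact: (ee o3)].
(* The columns of the two frames solve the same system with the same initial values. *)
apply/rowP => j; apply/eqP; rewrite -subr_eq0; apply/eqP.
apply: (uniq (fun i q => e' i q 0 j - e i q 0 j)) Sp => [m q Sq|m]; last first.
  by rewrite e_p0 e'_p0 subrr.
have [_ _ /(_ m q Sq)[/is_derive_mxP hu /is_derive_mxP hv]] := eP.
have [_ _ /(_ m q Sq)[/is_derive_mxP hu' /is_derive_mxP hv']] := eP'.
split; [apply: is_derive_eq (is_deriveB (hu' j) (hu j)) _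
       |apply: is_derive_eq (is_deriveB (hv' j) (hv j)) _];
  by rewrite !summxE -sumrB; apply: eq_bigr => n _; rewrite !mxE mulrBr.
Qed.
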